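(* Assume that a Lie group $G$ acts on $M$ (by a left or a right action), and let $A^1(M,M\times G)$ be the local formal Lie group of smooth maps $M\to G$ near the unit section, with the operation $\ast$. Then the Lie bracket of its Lie algebra $A^1(M,M\times\mathfrak g)\simeq C^\infty(M,\mathfrak g)$ is $-\llbracket\,\cdot\,,\,\cdot\,\rrbracket$.
   Context: Action and product. Write $\lambda(g,s)=g\cdot s$ for the action of $G$ on $M$: left if $h\cdot(g\cdot s)=(hg)\cdot s$, right if $h\cdot(g\cdot s)=(gh)\cdot s$. All considerations are local: $M$ is an open subset of $\mathbb R^p$. For smooth maps $g,h:M\to G$ set $(g\ast h)(s)=g(\lambda(h(s),s))h(s)$ if the action is left, and $(g\ast h)(s)=g(s)h(\lambda(g(s),s))$ if it is right. This product is associative with unit the constant map $e(s)=e$, and maps $C^1$-close to $e$ have a (local) $\ast$-inverse $g^{\ast-1}$. Lie bracket of the local group. For a smooth curve $h(\epsilon,\cdot)$ of maps $M\to G$ with $h(0,s)=e$ and $\frac{\partial h}{\partial\epsilon}|_{\epsilon=0}=x\in C^\infty(M,\mathfrak g)$, put $\mathrm{Ad}_\ast(g)(x)=\frac{d}{d\epsilon}|_{\epsilon=0}\,g\ast h(\epsilon,\cdot)\ast g^{\ast-1}$. For a smooth curve $g(\epsilon,\cdot)$ with $g(0,s)=e$ and $\frac{\partial g}{\partial\epsilon}|_{\epsilon=0}=y$, the Lie bracket of $y$ and $x$ is $\frac{d}{d\epsilon}|_{\epsilon=0}\mathrm{Ad}_\ast(g(\epsilon,\cdot))(x)$. Second bracket.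 Let $v_1,\dots,v_r$ be a basis of $\mathfrak g$ and $X_j(z)=\frac{d}{dt}|_{t=0}\exp(tv_j)\cdot z$ the infinitesimal vector fields. For $x=\sum_jx^jv_j$ and $y=\sum_jy^jv_j$ in $C^\infty(M,\mathfrak g)$, let $\rho(x)=\sum_jx^jX_j$, let $\mathcal L_{\rho(x)}y=\sum_j\rho(x)(y^j)v_j$, and let $[x,y](z)=[x(z),y(z)]$ be the pointwise bracket of $\mathfrak g$ (for matrix groups the commutator; in general $[v,w]=\frac{d}{dt}|_{t=0}\mathrm{Ad}(\exp tv)w$). Then $$\llbracket x,y\rrbracket=\mathcal L_{\rho(x)}y-\mathcal L_{\rho(y)}x-[x,y]\quad\text{(left action)},$$ $$\llbracket x,y\rrbracket=-\mathcal L_{\rho(x)}y+\mathcal L_{\rho(y)}x-[x,y]\quad\text{(right action)}.$$ *)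

(* Defs.v *)
From HB Require Import structures.
From mathcomp Require Import all_boot all_order all_algebra.
From mathcomp Require Import all_classical all_reals all_analysis.

Set Implicit Arguments.
Unset Strict Implicit.
Unset Printing Implicit Defensive.

Import Order.TTheory GRing.Theory Num.Theory.
Import numFieldNormedType.Exports.

Local Open Scope classical_set_scope.
Local Open Scope ring_scope.

(* [smooth_on U f] is C^oo-smoothness for U open in a finite-dimensional V:
   every iterated directional derivative of f is differentiable on U. *)
Definition smooth_on (R : realType) (V W : normedModType R)
    (U : set V) (f : V -> W) : Prop :=
  forall vs : seq V, forall x, U x ->
    differentiable (foldr (fun v g => 'D_v g) f vs) x.

Record chart (R : realType) (r : nat) (G : topologicalType) := Chart {
  cdom : set G;
  ccod : set 'rV[R]_r;
  cmap : G -> 'rV[R]_r;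
  cinv : 'rV[R]_r -> G;
  open_cdom : open cdom;
  open_ccod : open ccod;
  cmap_cod : forall g, cdom g -> ccod (cmap g);
  cinv_dom : forall u, ccod u -> cdom (cinv u);
  cmapK : forall g, cdom g -> cinv (cmap g) = g;
  cinvK : forall u, ccod u -> cmap (cinv u) = u;
  cmap_cont : {within cdom, continuous cmap};
  cinv_cont : {within ccod, continuous cinv} }.

Definition smooth_atlas (R : realType) (r : nat) (G : topologicalType)
    (A : set (chart R r G)) : Prop :=
  (forall g : G, exists2 a, A a & cdom a g) /\
  (forall a b, A a -> A b ->
    smooth_on (ccod a `&` [set u | cdom b (cinv a u)])
              (fun u => cmap b (cinv a u))).

(* Smoothness of a map from an open subset U of a finite-dimensional space V
   into the manifold G. *)
Definition smooth_into (R : realType) (r : nat) (G : topologicalType)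
    (A : set (chart R r G)) (V : normedModType R) (U : set V) (f : V -> G)
    : Prop :=
  (forall x, U x -> {for x, continuous f}) /\
  (forall c, A c ->
    smooth_on (U `&` [set x | cdom c (f x)]) (fun x => cmap c (f x))).

(* Smoothness of a map whose source involves G is expressed by composing with
   inverse charts. *)
HB.mixin Record isLieGroup (R : realType) (r : nat) G
    of Topological G & Group G := {
  lie_atlas : set (chart R r G);
  lie_atlasP : smooth_atlas lie_atlas;
  lie_hausdorff : hausdorff_space G;
  lie_second_countable : @second_countable G;
  lie_mul_smooth : forall a b, lie_atlas a -> lie_atlas b ->
    smooth_into lie_atlas (ccod a `*` ccod b)
      (fun u : 'rV[R]_r * 'rV[R]_r => (cinv a u.1 * cinv b u.2)%g);
  lie_inv_smooth : forall a, lie_atlas a ->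
    smooth_into lie_atlas (ccod a) (fun u => ((cinv a u)^-1)%g) }.

#[short(type="lieGroupType")]
HB.structure Definition LieGroup (R : realType) (r : nat) :=
  { G of isLieGroup R r G & Topological G & Group G }.

Variant action_side := LeftAction | RightAction.

(* The element acting as "first h, then g". *)
Definition side_mul (R : realType) (r : nat) (G : lieGroupType R r)
    (sd : action_side) (g h : G) : G :=
  match sd with LeftAction => (g * h)%g | RightAction => (h * g)%g end.

(* A (left or right) smooth action of G on the open set M, defined on an open
   neighbourhood D of {1} x M in G x M.  An everywhere defined action is the
   case D = setT `*` M; restricting an action on a manifold to a coordinate
   domain M gives in general a smaller D.  Outside D, [act] is arbitrary. *)
Record local_action (R : realType) (p r : nat) (G : lieGroupType R r)
    (sd : action_side) (M : set 'rV[R]_p) (D : set (G * 'rV[R]_p))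
    (act : G -> 'rV[R]_p -> 'rV[R]_p) : Prop := LocalAction {
  act_open : open D;
  act_dom : forall g s, D (g, s) -> M s;
  act_cod : forall g s, D (g, s) -> M (act g s);
  act_dom1 : forall s, M s -> D (1%g, s);
  act1s : forall s, M s -> act 1%g s = s;
  act_comp : forall g h s, D (h, s) -> D (g, act h s) ->
    D (side_mul sd g h, s) -> act g (act h s) = act (side_mul sd g h) s;
  act_smooth : forall a, lie_atlas (s := G) a ->
    smooth_on [set z : 'rV[R]_r * 'rV[R]_p | ccod a z.1 /\ D (cinv a z.1, z.2)]
              (fun z : 'rV[R]_r * 'rV[R]_p => act (cinv a z.1) z.2) }.

Section LocalGroup.
Variables (R : realType) (p r : nat) (G : lieGroupType R r).

(* A chart [e] whose domain contains the unit identifies the Lie algebra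
   T_1 G with 'rV[R]_r.  [velocity e c] is the tangent vector at parameter 0 of
   a curve c in G with c 0 = 1, in the coordinates e. *)
Variable e : chart R r G.

Definition has_velocity (c : R -> G) (w : 'rV[R]_r) : Prop :=
  c 0 = 1%g /\ is_derive (0 : R) 1 (fun t => cmap e (c t)) w.

Definition velocity (c : R -> G) : 'rV[R]_r := derive1 (fun t => cmap e (c t)) 0.

(* [expG] is the exponential map of G: t |-> expG (t v) is the one-parameter
   subgroup of G with velocity v. *)
Definition is_lie_exp (expG : 'rV[R]_r -> G) : Prop :=
  forall v : 'rV[R]_r,
    [/\ smooth_into (lie_atlas (s := G)) [set: R^o]
          (fun t : R^o => expG ((t : R) *: v)),
        forall t u : R, expG ((t + u) *: v) = (expG (t *: v) * expG (u *: v))%g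
      & has_velocity (fun t => expG (t *: v)) v].

Variable expG : 'rV[R]_r -> G.

Definition lie_Ad (g : G) (w : 'rV[R]_r) : 'rV[R]_r :=
  velocity (fun t => g * expG (t *: w) * g^-1)%g.

Definition lie_br (v w : 'rV[R]_r) : 'rV[R]_r :=
  derive1 (fun t : R => lie_Ad (expG (t *: v)) w) 0.

Variables (sd : action_side) (M : set 'rV[R]_p).
Variable act : G -> 'rV[R]_p -> 'rV[R]_p.

Definition inf_field (v : 'rV[R]_r) (z : 'rV[R]_p) : 'rV[R]_p :=
  derive1 (fun t : R => act (expG (t *: v)) z) 0.

Variable v : r.-tuple 'rV[R]_r.

Definition rho (x : 'rV[R]_p -> 'rV[R]_r) (z : 'rV[R]_p) : 'rV[R]_p :=
  \sum_(j < r) coord v j (x z) *: inf_field (tnth v j) z.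

Definition lie_deriv (x y : 'rV[R]_p -> 'rV[R]_r) (z : 'rV[R]_p) : 'rV[R]_r :=
  \sum_(j < r)
    'D_(rho x z) (fun s => coord v j (y s) : R^o) z *: tnth v j.

Definition dbracket (x y : 'rV[R]_p -> 'rV[R]_r) (z : 'rV[R]_p) : 'rV[R]_r :=
  match sd with
  | LeftAction => lie_deriv x y z - lie_deriv y x z - lie_br (x z) (y z)
  | RightAction => - lie_deriv x y z + lie_deriv y x z - lie_br (x z) (y z)
  end.

Definition star (g h : 'rV[R]_p -> G) (s : 'rV[R]_p) : G :=
  match sd with
  | LeftAction => (g (act (h s) s) * h s)%g
  | RightAction => (g s * h (act (g s) s))%g
  end.

(* A smooth curve h(t, .) of maps M -> G through the unit section, with
   velocity x; it is required to be smooth near {0} x M only. *)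
Definition unit_curve (h : R -> 'rV[R]_p -> G) (x : 'rV[R]_p -> 'rV[R]_r)
    : Prop :=
  exists W : set (R^o * 'rV[R]_p),
    [/\ open W,
        forall s, M s -> W (0, s),
        smooth_into (lie_atlas (s := G)) W
          (fun z : R^o * 'rV[R]_p => h z.1 z.2)
      & forall s, M s -> has_velocity (fun t => h t s) (x s)].

(* k(t, .) is the local *-inverse of g(t, .), for t near 0: a smooth map close
   to the unit section.  Closeness is what selects the inverse among the
   solutions of the two equations, so it is part of the definition. *)
Definition star_inverse (g k : R -> 'rV[R]_p -> G) : Prop :=
  exists W : set (R^o * 'rV[R]_p),
    [/\ open W,
        forall s, M s -> W (0, s),
        forall t, smooth_into (lie_atlas (s := G)) [set s | W (t, s)] (k t),
        forall t s, W (t, s) ->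
          star (g t) (k t) s = 1%g /\ star (k t) (g t) s = 1%g
      & forall s, M s ->
          (fun z : R^o * 'rV[R]_p => k z.1 z.2) @ ((0 : R^o), s) --> (1%g : G)].

(* [is_star_Ad g k x s w]: for g with *-inverse k, Ad_*(g)(x) is well defined
   at s (independent of the curve h with velocity x) and equal to w. *)
Definition is_star_Ad (g k : 'rV[R]_p -> G) (x : 'rV[R]_p -> 'rV[R]_r)
    (s : 'rV[R]_p) (w : 'rV[R]_r) : Prop :=
  (exists h, unit_curve h x) /\
  (forall h, unit_curve h x ->
     has_velocity (fun t => star (star g (h t)) k s) w).

(* [is_star_bracket y x s z]: the Lie bracket of y and x in the Lie algebra of
   the local group, at the point s, is z. *)
Definition is_star_bracket (y x : 'rV[R]_p -> 'rV[R]_r)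
    (s : 'rV[R]_p) (z : 'rV[R]_r) : Prop :=
  forall g k, unit_curve g y -> star_inverse g k ->
    exists2 A : R -> 'rV[R]_r,
      \forall t \near (0 : R), is_star_Ad (g t) (k t) x s (A t)
    & is_derive (0 : R) 1 A z.

End LocalGroup.

(* Main.v *)
(* In a chart around the unit of [G], write m for the multiplication, and let
   g_t be a curve of maps with velocity y and k_t its star-inverse.  The velocity
   A_t of g_t * h * k_t, where h has velocity x, is not computed from k_t but from
   the relation (g_t * h * k_t) * g_t = g_t * h.  For a left action, taken at the
   point q_t = k_t(s) . s, it reads
     D_1 m(1, g_t) A_t = T_t x(q_t) + D_2 m(g_t, 1) x(q_t),
   and for a right action, with q_t = g_t(s) . s,
     D_1 m(1, g_t) A_t + T_t A_t = D_2 m(g_t, 1) x(q_t),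
   where T_t w is the derivative of g_t along the fundamental field of w.  At
   t = 0 both sides reduce to the identity and T_0 = 0, so that differentiating
   at t = 0 only needs the derivatives of the coefficients: those of D_2 m and
   D_1 m differ by the bracket of the Lie algebra, that of T_t w is the derivative
   of y along the fundamental field of w (by symmetry of second derivatives), and
   the velocity of q_t is -/+ the fundamental field of y. *)
From HB Require Import structures.
Require Import Defs.
From mathcomp Require Import all_boot all_order all_algebra.
From mathcomp Require Import all_classical all_reals all_analysis.
From mathcomp Require Import ring lra.
Import Order.TTheory GRing.Theory Num.Theory.
Import numFieldNormedType.Exports.
Local Open Scope classical_set_scope.
Local Open Scope ring_scope.

Set Implicit Arguments.
Unset Strict Implicit.
Unset Printing Implicit Defensive.

(** * Directional derivatives *)

Section Calculus.
Context {R : realType}.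
Implicit Types U V W : normedModType R.

(** The obstacle is the weak regularity of [k] in the parameter: each [k t] is smooth in the point,
    but jointly [k] is only known to be continuous at parameter 0. No formula containing [k] can be
    differentiated in t directly, and nothing is known in advance about the regularity of A_t.
    Multiplying by g_t trades [k] for [g], which is jointly smooth; the resulting equation is linear
    in A_t and close to the identity, and this forces A_t to be bounded, then continuous, then
    differentiable at 0. The two sides differ in where [k] is evaluated. For a left action it is
    evaluated at s: it is a single group element and cancels, but q_t still depends on it, and the
    velocity of q_t is extracted from g * k = 1 by an implicit function argument. For a right action
    q_t depends on [g] only, but [k] is evaluated at a point moved by g_t * h; the relation k * g =
    1 at that point removes it, at the price of evaluating g_t at a point moved by the conjugate, so
    that the unknown enters a second time. *)

Lemma near_eq_differentiable V W (f g : V -> W) (a : V) :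
  (\forall x \near a, f x = g x) -> differentiable f a -> differentiable g a.
Proof.
move=> fg df; have [dfc dfa] := (diff_locallyP _ _).1 df.
have fga := nbhs_singleton fg.
have gE : g \o shift a = cst (g a) + 'd f a +o_ 0 id.
  apply/eqaddoP => _/posnumP[eps].
  have /eqaddoP/(_ eps%:num)/(_ [gt0 of eps%:num]) := dfa.
  have fg0 : \forall x \near (0 : V), f (x + a) = g (x + a).
    by move: fg; rewrite (near_shift 0) subr0.
  apply: filter_app; near=> x; rewrite /= -fga.
  by rewrite !fctE /= (near fg0 x _).
have dE : 'd g a = 'd f a :> (V -> W) by apply: diff_unique.
by apply/diff_locallyP; rewrite dE; split.
Unshelve. all: by end_near. Qed.

Lemma derive_comp U V W (f : U -> V) (g : V -> W) (x v : U) :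
  differentiable f x -> differentiable g (f x) ->
  'D_v (fun z => g (f z)) x = 'D_('D_v f x) g (f x).
Proof.
move=> df dg; have dgf : differentiable (g \o f) x by exact: differentiable_comp.
by rewrite (deriveE _ dgf) (deriveE _ df) (deriveE _ dg) diff_comp.
Qed.

Lemma is_derive_comp V W (c : R -> V) (g : V -> W) (t : R) (dc : V) :
  is_derive t 1 c dc -> differentiable g (c t) ->
  is_derive t 1 (fun z => g (c z)) ('D_dc g (c t)).
Proof.
move=> [/derivable1_diffP cd <-] dg.
have dgc : differentiable (fun z => g (c z)) t by exact: differentiable_comp.
by split; [exact: diff_derivable|rewrite derive_comp].
Qed.

Lemma is_derive_pair V W (c : R -> V) (d : R -> W) (t : R) dc dd :
  is_derive t 1 c dc -> is_derive t 1 d dd ->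
  is_derive t 1 (fun z => (c z, d z)) (dc, dd).
Proof.
move=> [/derivable1_diffP cd <-] [/derivable1_diffP hd <-].
have ch := differentiable_pair cd hd.
split; first exact: diff_derivable.
by rewrite (deriveE _ ch) diff_pair //= (deriveE _ cd) (deriveE _ hd).
Qed.

Lemma derive_pair U V W (f : U -> V) (g : U -> W) (x v : U) :
  differentiable f x -> differentiable g x ->
  'D_v (fun z => (f z, g z)) x = ('D_v f x, 'D_v g x).
Proof.
move=> df dg; have dfg := differentiable_pair df dg.
by rewrite (deriveE _ dfg) diff_pair //= (deriveE _ df) (deriveE _ dg).
Qed.

Lemma derive_dirD V W (f : V -> W) x v w : differentiable f x ->
  'D_(v + w) f x = 'D_v f x + 'D_w f x.
Proof. by move=> df; rewrite !(deriveE _ df) linearD. Qed.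

Lemma derive_dirZ V W (f : V -> W) x k v : differentiable f x ->
  'D_(k *: v) f x = k *: 'D_v f x.
Proof. by move=> df; rewrite !(deriveE _ df) linearZ. Qed.

Lemma derive_dirN V W (f : V -> W) x v : differentiable f x ->
  'D_(- v) f x = - 'D_v f x.
Proof. by move=> df; rewrite !(deriveE _ df) linearN. Qed.

Lemma derive_dir_sum V W (f : V -> W) x n (v : 'I_n -> V) :
  differentiable f x -> 'D_(\sum_i v i) f x = \sum_i 'D_(v i) f x.
Proof.
by move=> df; rewrite !(deriveE _ df) linear_sum; apply: eq_bigr => i _; rewrite deriveE.
Qed.

Lemma derive_linear V W (f : {linear V -> W}) x v : continuous f ->
  'D_v f x = f v.
Proof. by move=> fc; rewrite deriveE ?diff_lin//; exact: linear_differentiable. Qed.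

Lemma derive_linear_comp U V W (f : U -> V) (g : {linear V -> W}) (x v : U) :
  continuous g -> differentiable f x ->
  'D_v (fun z => g (f z)) x = g ('D_v f x).
Proof.
by move=> gc df; rewrite derive_comp ?derive_linear//; exact: linear_differentiable.
Qed.

Lemma derive_pair_split V W U (f : V * W -> U) x v w : differentiable f x ->
  'D_(v, w) f x = 'D_(v, 0) f x + 'D_(0, w) f x.
Proof.
move=> df; rewrite -derive_dirD//; congr ('D_ _ f x).
by congr (_, _); rewrite /= ?addr0 ?add0r.
Qed.

End Calculus.

(** * Smoothness is stable under composition *)

Section Smooth.
Context {R : realType}.
Implicit Types U V W : normedModType R.

(** Scaling is viewed as a bilinear map so that the product rule for [k z *: f z] becomes an
    instance of the differential of a continuous bilinear map. *)
Lemma scale_is_bilinear W :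
  bilinear_for (GRing.Scale.Law.clone _ _ *:%R _)
    (GRing.Scale.Law.clone _ _ *:%R _)
    (fun (k : R^o) (w : W) => k *: w).
Proof.
split=> [u'|u] a x y /=; first by rewrite scalerDl scalerA.
by rewrite scalerDr !scalerA mulrC.
Qed.

Lemma is_diff_scale V W (k : V -> R^o) (f : V -> W) (x : V) :
  differentiable k x -> differentiable f x ->
  is_diff x (fun z => k z *: f z) (fun v => k x *: 'd f x v + 'd k x v *: f x).
Proof.
move=> dk df.
pose sM := bilinear_isBilinear.Build _ _ _ _ _ _ _ (@scale_is_bilinear W).
pose s : {bilinear R^o -> W -> W} := HB.pack (fun (k : R^o) (w : W) => k *: w) sM.
have sc : continuous (fun p : R^o * W => s p.1 p.2).
  by move=> p; exact: scale_continuous.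
have ds := differentiable_bilin (k x, f x) sc.
have dkf := differentiable_pair dk df.
apply: DiffDef; first exact: (differentiable_comp dkf ds).
rewrite -[fun z => k z *: f z]/((fun p : R^o * W => s p.1 p.2) \o (fun z => (k z, f z))).
by rewrite diff_comp // diff_bilin // diff_pair.
Qed.

Lemma differentiable_scale V W (k : V -> R^o) (f : V -> W) (x : V) :
  differentiable k x -> differentiable f x ->
  differentiable (fun z => k z *: f z) x.
Proof. by move=> dk df; have [] := is_diff_scale dk df. Qed.

Lemma derive_scale V W (k : V -> R^o) (f : V -> W) (x v : V) :
  differentiable k x -> differentiable f x ->
  'D_v (fun z => k z *: f z) x = k x *: 'D_v f x + 'D_v k x *: f x.
Proof.
move=> dk df; have [dkf dE] := is_diff_scale dk df.
by rewrite (deriveE _ dkf) dE (deriveE _ df) (deriveE _ dk).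
Qed.

Lemma differentiable_entry V q (f : V -> 'rV[R]_q) (x : V) (j : 'I_q) :
  differentiable f x -> differentiable (fun z => f z 0 j : R^o) x.
Proof.
move=> df.
apply: (@differentiable_comp _ _ _ _ f (fun N : 'rV[R]_q => N 0 j : R^o)) => //.
exact: differentiable_coord.
Qed.

Lemma derive_entry V q (f : V -> 'rV[R]_q) (x v : V) (j : 'I_q) :
  differentiable f x ->
  'D_v (fun z => f z 0 j : R^o) x = 'D_v f x 0 j.
Proof.
by move=> df; rewrite derive_mx ?mxE//; exact: diff_derivable.
Qed.

Lemma derive_basis q W (f : 'rV[R]_q -> W) (x v : 'rV[R]_q) :
  differentiable f x ->
  'D_v f x = \sum_(j < q) v 0 j *: 'D_(delta_mx 0 j) f x.
Proof.
move=> df; rewrite {1}(row_sum_delta v) derive_dir_sum//.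
by apply: eq_bigr => j _; rewrite derive_dirZ.
Qed.

Lemma derive_fst U V (v x : U * V) : 'D_v fst x = v.1.
Proof. by rewrite (@derive_linear _ _ _ (@fst U V))// => z; exact: cvg_fst. Qed.

Lemma derive_snd U V (v x : U * V) : 'D_v snd x = v.2.
Proof. by rewrite (@derive_linear _ _ _ (@snd U V))// => z; exact: cvg_snd. Qed.

Lemma differentiable_fst U V (x : U * V) : differentiable fst x.
Proof.
by apply: (@linear_differentiable _ _ _ (@fst U V)) => z; exact: cvg_fst.
Qed.

Lemma differentiable_snd U V (x : U * V) : differentiable snd x.
Proof.
by apply: (@linear_differentiable _ _ _ (@snd U V)) => z; exact: cvg_snd.
Qed.

(** Counting derivatives makes induction possible: the derivative of a product or a composite is
    built from factors with one derivative less to spare. [smooth_on] is the conjunction over all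
    orders and offers no such induction by itself. *)
Fixpoint Cn (n : nat) V W (A : set V) (f : V -> W) : Prop :=
  (forall x, A x -> differentiable f x) /\
  if n is n'.+1 then forall v, Cn n' A ('D_v f) else True.

Lemma Cn_diff n V W (A : set V) (f : V -> W) x : Cn n A f -> A x -> differentiable f x.
Proof. by case: n => [|n] [] + _; exact. Qed.

Lemma CnW n V W (A : set V) (f : V -> W) : Cn n.+1 A f -> Cn n A f.
Proof.
elim: n f => [|n IH] f [df Df]; first by split.
by split=> // v; exact: IH.
Qed.

Lemma smooth_on_derive V W (A : set V) (f : V -> W) v :
  smooth_on A f -> smooth_on A ('D_v f).
Proof. by move=> fA vs x Ax; have := fA (rcons vs v) x Ax; rewrite foldr_rcons. Qed.

Lemma smooth_on_diff V W (A : set V) (f : V -> W) x :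
  smooth_on A f -> A x -> differentiable f x.
Proof. by move=> fA; exact: (fA [::]). Qed.

Lemma smooth_onP V W (A : set V) (f : V -> W) :
  smooth_on A f <-> forall n, Cn n A f.
Proof.
split=> [fA n|fA vs].
  elim: n f fA => [|n IH] f fA; first by split=> // x; exact: smooth_on_diff.
  split=> [x|v]; first exact: smooth_on_diff.
  by apply: IH; exact: smooth_on_derive.
elim/last_ind: vs f fA => [|vs v IH] f fA.
  by move=> x Ax; exact: (Cn_diff (fA 0%N) Ax).
by rewrite foldr_rcons; apply: IH => n; have [_] := fA n.+1; exact.
Qed.

(** Derivative formulas are only valid on [A]. Since [A] is open, equality on [A] is equality near
    each of its points and passes to derivatives. *)
Lemma Cn_ext n V W (A : set V) (f g : V -> W) : open A ->
  (forall x, A x -> f x = g x) -> Cn n A f -> Cn n A g.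
Proof.
move=> oA; elim: n f g => [|n IH] f g fg fA.
  split=> // x Ax; apply: near_eq_differentiable (Cn_diff fA Ax).
  by near=> z; apply: fg; near: z; exact: open_nbhs_nbhs.
split=> [x Ax|v].
  apply: near_eq_differentiable (Cn_diff fA Ax).
  by near=> z; apply: fg; near: z; exact: open_nbhs_nbhs.
apply: (IH ('D_v f)); last by case: fA => _; exact.
move=> x Ax; apply: near_eq_derive.
by near=> z; apply: fg; near: z; exact: open_nbhs_nbhs.
Unshelve. all: by end_near. Qed.

Lemma Cn_sub n V W (A B : set V) (f : V -> W) : A `<=` B -> Cn n B f -> Cn n A f.
Proof.
move=> AB; elim: n f => [|n IH] f [df Df].
  by split=> // x /AB; exact: df.
by split=> [x /AB|v]; [exact: df|apply: IH; exact: Df].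
Qed.

Lemma Cn_cst n V W (A : set V) (w : W) : Cn n A (fun _ => w).
Proof.
elim: n w => [|n IH] w; split=> // v.
by rewrite (_ : 'D_v _ = fun=> 0)//; apply/funext => x; rewrite derive_cst.
Qed.

Lemma Cn_add n V W (A : set V) (f g : V -> W) : open A ->
  Cn n A f -> Cn n A g -> Cn n A (fun x => f x + g x).
Proof.
move=> oA; elim: n f g => [|n IH] f g fA gA.
  by split=> // x Ax; exact: (differentiableD (Cn_diff fA Ax) (Cn_diff gA Ax)).
split=> [x Ax|v].
  exact: (differentiableD (Cn_diff fA Ax) (Cn_diff gA Ax)).
apply: (@Cn_ext _ _ _ _ (fun x => 'D_v f x + 'D_v g x)) => //.
  move=> x Ax; rewrite -deriveD //.
    exact: diff_derivable (Cn_diff fA Ax).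
  exact: diff_derivable (Cn_diff gA Ax).
by apply: IH; [case: fA => _; exact|case: gA => _; exact].
Qed.

Lemma Cn_sum n V W (A : set V) m (f : 'I_m -> V -> W) : open A ->
  (forall i, Cn n A (f i)) -> Cn n A (fun x => \sum_i f i x).
Proof.
move=> oA fA; elim: m f fA => [|m IH] f fA.
  rewrite (_ : (fun x => _) = fun=> 0); first exact: Cn_cst.
  by apply/funext => x; rewrite big_ord0.
rewrite (_ : (fun x => _) =
    (fun x => \sum_(i < m) f (widen_ord (leqnSn m) i) x + f ord_max x)).
  by apply: Cn_add => //; exact: IH.
by apply/funext => x; rewrite big_ord_recr.
Qed.

Lemma Cn_scale n V W (A : set V) (k : V -> R^o) (f : V -> W) : open A ->
  Cn n A k -> Cn n A f -> Cn n A (fun x => k x *: f x).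
Proof.
move=> oA; elim: n k f => [|n IH] k f kA fA.
  by split=> // x Ax; exact: (differentiable_scale (Cn_diff kA Ax) (Cn_diff fA Ax)).
split=> [x Ax|v].
  exact: (differentiable_scale (Cn_diff kA Ax) (Cn_diff fA Ax)).
apply: (@Cn_ext _ _ _ _ (fun x => k x *: 'D_v f x + 'D_v k x *: f x)) => //.
  by move=> x Ax; rewrite derive_scale//; [exact: (Cn_diff kA)|exact: (Cn_diff fA)].
by apply: Cn_add => //; apply: IH;
  [exact: CnW|case: fA => _; exact|case: kA => _; exact|exact: CnW].
Qed.

Lemma Cn_entry n V q (A : set V) (f : V -> 'rV[R]_q) (j : 'I_q) : open A ->
  Cn n A f -> Cn n A (fun x => f x 0 j : R^o).
Proof.
move=> oA; elim: n f => [|n IH] f fA.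
  by split=> // x Ax; exact: differentiable_entry (Cn_diff fA Ax).
split=> [x Ax|v]; first exact: differentiable_entry (Cn_diff fA Ax).
apply: (@Cn_ext _ _ _ _ (fun x => 'D_v f x 0 j)) => //.
  by move=> x Ax; rewrite derive_entry//; exact: (Cn_diff fA).
by apply: IH; case: fA => _; exact.
Qed.

(** The middle space consists of rows so that the chain rule can be expanded in the standard basis:
    [g] is then differentiated in fixed directions, and the induction applies to each
    ['D_(delta_mx 0 j) g]. *)
Lemma Cn_comp_row n V q W (A : set V) (B : set 'rV[R]_q) (f : V -> 'rV[R]_q)
    (g : 'rV[R]_q -> W) : open A -> (forall x, A x -> B (f x)) ->
  Cn n A f -> Cn n B g -> Cn n A (fun x => g (f x)).
Proof.
move=> oA AB; elim: n g => [|n IH] g fA gB.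
  split=> // x Ax; apply: (differentiable_comp (Cn_diff fA Ax)).
  exact: (Cn_diff gB (AB _ Ax)).
have dg x : A x -> differentiable g (f x) by move=> /AB; exact: (Cn_diff gB).
split=> [x Ax|v]; first exact: (differentiable_comp (Cn_diff fA Ax) (dg _ Ax)).
apply: (@Cn_ext _ _ _ _
  (fun x => \sum_(j < q) ('D_v f x 0 j : R^o) *: 'D_(delta_mx 0 j) g (f x))) => //.
  move=> x Ax.
  by rewrite (derive_comp _ (Cn_diff fA Ax) (dg _ Ax)) (derive_basis _ (dg _ Ax)).
apply: Cn_sum => // j; apply: Cn_scale => //.
  by apply: Cn_entry => //; case: fA => _; exact.
by apply: (IH ('D_(delta_mx 0 j) g)); [exact: CnW|case: gB => _; exact].
Qed.

Lemma Cn_fst n U V (A : set (U * V)) : Cn n A fst.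
Proof.
case: n => [|n]; first by split=> // x _; exact: differentiable_fst.
split=> [x _|v]; first exact: differentiable_fst.
by rewrite (_ : 'D_v _ = fun=> v.1);
  [exact: Cn_cst|apply/funext => x; rewrite derive_fst].
Qed.

Lemma Cn_snd n U V (A : set (U * V)) : Cn n A snd.
Proof.
case: n => [|n]; first by split=> // x _; exact: differentiable_snd.
split=> [x _|v]; first exact: differentiable_snd.
by rewrite (_ : 'D_v _ = fun=> v.2);
  [exact: Cn_cst|apply/funext => x; rewrite derive_snd].
Qed.

End Smooth.

(** * Symmetry of second derivatives *)

Section Estimates.
Context {R : realType}.
Implicit Types U V W : normedModType R.

Lemma differentiable_bound V W (g : V -> W) (x : V) (eps : R) :
  differentiable g x -> 0 < eps ->
  exists2 d : R, 0 < d & forall k, `|k| < d ->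
    `|g (k + x) - g x - 'D_k g x| <= eps * `|k|.
Proof.
move=> dg e0; have [_ /eqaddoP/(_ eps e0)] := (diff_locallyP _ _).1 dg.
move=> /nbhs_normP[d /= d0 dH]; exists d => // k kd.
have := dH k; rewrite /= sub0r normrN => /(_ kd).
by rewrite (deriveE _ dg) !fctE /= opprD addrA.
Qed.

Lemma is_derive_line V (v c : V) (a : R) : is_derive a 1 (fun t : R => t *: v + c) v.
Proof.
have dl : is_diff a (fun t : R => t *: v + c) (( *:%R^~ v) + 0).
  exact: is_diffD.
split; first by apply: diff_derivable; case: dl.
by rewrite (deriveE _ (ex_diff (is_diff_def:=dl))) diff_val /= !fctE scale1r addr0.
Qed.

(** The mean value theorem in the direction v turns the second difference into h times an increment
    of ['D_v f], and that increment is expanded to first order about x. *)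
Lemma second_difference V (f : V -> R^o) (x v w : V) (eps : R) :
  (\forall z \near x, differentiable f z) -> differentiable ('D_v f) x ->
  0 < eps -> \forall h \near (0 : R)^'+,
  `|f (h *: v + h *: w + x) - f (h *: v + x) - f (h *: w + x) + f x
    - h ^+ 2 * 'D_w ('D_v f) x| <= eps * h ^+ 2.
Proof.
move=> /nbhs_normP[d1 /= d10 fd] dg e0.
(* [C] controls displacements: a v + b w has norm at most h C when a and b lie between 0 and h, and
   the summand 1 makes [C] positive. Two first-order errors of eps / (2 C) times h C, multiplied by
   h, add up to eps h^2. *)
set C : R := `|v| + `|w| + 1.
have C0 : 0 < C by rewrite ltr_wpDl// addr_ge0.
have e'0 : 0 < eps / (2 * C) by rewrite divr_gt0// mulr_gt0.
have [d2 d20 gd] := differentiable_bound dg e'0.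
near=> h.
have h0 : 0 < h by near: h; exact: nbhs_right_gt.
have hd : h * C < Num.min d1 d2.
  rewrite -ltr_pdivlMr//; near: h; apply: nbhs_right_lt.
  by rewrite divr_gt0// lt_min d10.
have small a : 0 <= a -> a <= h -> forall b, 0 <= b -> b <= h ->
    `|a *: v + b *: w| <= h * C.
  move=> a0 ah b b0 bh; rewrite (le_trans (ler_normD _ _))// !normrZ !ger0_norm//.
  by rewrite /C !mulrDr mulr1 -[leLHS]addr0 !lerD ?ler_wpM2r// ltW.
have fd' a : 0 <= a -> a <= h -> forall b, 0 <= b -> b <= h ->
    differentiable f (a *: v + b *: w + x).
  move=> a0 ah b b0 bh; apply: fd; rewrite /= opprD addrC subrK normrN.
  rewrite (le_lt_trans (small _ a0 ah _ b0 bh))// (lt_le_trans hd)//.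
  by rewrite ge_min lexx.
pose phi (a : R) : R^o := f (a *: v + (h *: w + x)) - f (a *: v + x).
pose dphi (a : R) : R := 'D_v f (a *: v + (h *: w + x)) - 'D_v f (a *: v + x).
have hh : 0 <= h := ltW h0.
have dphiP a : 0 <= a -> a <= h -> is_derive a 1 phi (dphi a).
  move=> a0 ah; apply: is_deriveB.
    apply: (is_derive_comp (is_derive_line v (h *: w + x) a)).
    by rewrite addrA; exact: fd'.
  apply: (is_derive_comp (is_derive_line v x a)).
  by have := fd' a a0 ah 0 (lexx _) hh; rewrite scale0r addr0.
have phid a : a \in `]0, h[ -> is_derive a 1 phi (dphi a).
  by rewrite in_itv /= => /andP[/ltW ? /ltW ?]; exact: dphiP.
have phic : {within `[0, h], continuous phi}.
  apply: derivable_within_continuous => a; rewrite in_itv /= => /andP[a0 ah].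
  by have [] := dphiP a a0 ah.
have [c] := MVT h0 phid phic.
rewrite in_itv /= => /andP[/ltW c0 /ltW ch] E.
have bnd b : 0 <= b -> b <= h -> `|'D_v f (c *: v + b *: w + x) - 'D_v f x
     - 'D_(c *: v + b *: w) ('D_v f) x| <= eps / (2 * C) * (h * C).
  move=> b0 bh; have kC := small c c0 ch b b0 bh.
  rewrite (le_trans (gd _ (le_lt_trans kC (lt_le_trans hd _))))//.
    by rewrite ge_min lexx orbT.
  by rewrite ler_pM2l.
have B1 := bnd h hh (lexx _).
have := bnd 0 (lexx _) hh; rewrite scale0r addr0 => B2.
move: B1; rewrite (derive_dirD _ _ dg) (derive_dirZ h w dg) => B1.
have -> : f (h *: v + h *: w + x) - f (h *: v + x) - f (h *: w + x) + f x =
    h * dphi c.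
  move: E; rewrite subr0 mulrC => <-.
  by rewrite /phi !scale0r !add0r !addrA opprB addrA addrAC.
rewrite /dphi addrA.
set P := 'D_v f (c *: v + h *: w + x) in B1 *.
set Q := 'D_v f (c *: v + x) in B2 *.
set g0 := 'D_v f x in B1 B2; set S := 'D_(c *: v) ('D_v f) x in B1 B2.
have -> : h * (P - Q) - h ^+ 2 * 'D_w ('D_v f) x =
    h * ((P - g0 - (S + h *: 'D_w ('D_v f) x)) - (Q - g0 - S)).
  by rewrite /GRing.scale /=; ring.
rewrite normrM gtr0_norm// (le_trans (ler_wpM2l hh (ler_normB _ _)))//.
rewrite (le_trans (ler_wpM2l hh (lerD B1 B2)))//.
have -> : h * (eps / (2 * C) * (h * C) + eps / (2 * C) * (h * C)) = eps * h ^+ 2.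
  by field; rewrite gt_eqF.
by [].
Unshelve. all: by end_near. Qed.

(** The second difference is symmetric in v and w, and both iterated derivatives approximate it up
    to (eps / 2) h^2 for the same small h > 0. *)
Lemma derive_comm_scalar V (f : V -> R^o) (x v w : V) :
  (\forall z \near x, differentiable f z) ->
  differentiable ('D_v f) x -> differentiable ('D_w f) x ->
  'D_w ('D_v f) x = 'D_v ('D_w f) x.
Proof.
move=> fd dv dw; apply/eqP; rewrite -subr_eq0 -normr_le0.
apply/ler_addgt0Pr => eps e0; rewrite add0r.
have e20 : 0 < eps / 2 by rewrite divr_gt0.
have Hv := @second_difference _ f x v w _ fd dv e20.
have Hw := @second_difference _ f x w v _ fd dw e20.
have gt0 : \forall h \near (0 : R)^'+, 0 < h by exact: nbhs_right_gt.
have [h [[{}Hv {}Hw] h0]] := filter_ex (filterI (filterI Hv Hw) gt0).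
have h20 : 0 < h ^+ 2 by rewrite exprn_gt0.
rewrite -(ler_pM2r h20).
have aux (p q1 q2 c a b : R) :
    `|p - q1 - q2 + c - h ^+ 2 * a| <= eps / 2 * h ^+ 2 ->
    `|p - q2 - q1 + c - h ^+ 2 * b| <= eps / 2 * h ^+ 2 ->
    `|a - b| * h ^+ 2 <= eps * h ^+ 2.
  move=> Ha Hb; rewrite -[X in _ * X <= _]gtr0_norm// -normrM.
  have := le_trans (ler_normB _ _) (lerD Hb Ha).
  by rewrite -mulrDl -splitr; congr (`| _ | <= _); ring.
by apply: aux Hv _; rewrite [h *: v + h *: w]addrC.
Qed.

Lemma derive_comm V q (A : set V) (f : V -> 'rV[R]_q) (x v w : V) :
  open A -> A x -> smooth_on A f -> 'D_w ('D_v f) x = 'D_v ('D_w f) x.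
Proof.
move=> oA Ax fA.
have nearA : \forall z \near x, A z by exact: open_nbhs_nbhs.
have entry u u' j : 'D_u' ('D_u f) x 0 j =
    'D_u' ('D_u (fun z => f z 0 j : R^o)) x.
  rewrite -(derive_entry _ _ (smooth_on_diff (smooth_on_derive u fA) Ax)).
  apply: near_eq_derive; apply: filterS nearA => z Az.
  by rewrite (derive_entry _ _ (smooth_on_diff fA Az)).
apply/rowP => j; apply: etrans (entry v w j) _.
apply: etrans (esym (entry w v j)).
apply: derive_comm_scalar.
- apply: filterS nearA => z Az; apply: differentiable_entry.
  exact: smooth_on_diff fA Az.
- have := differentiable_entry j (smooth_on_diff (smooth_on_derive v fA) Ax).
  apply: near_eq_differentiable; apply: filterS nearA => z Az.
  by rewrite (derive_entry _ _ (smooth_on_diff fA Az)).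
- have := differentiable_entry j (smooth_on_diff (smooth_on_derive w fA) Ax).
  apply: near_eq_differentiable; apply: filterS nearA => z Az.
  by rewrite (derive_entry _ _ (smooth_on_diff fA Az)).
Qed.

End Estimates.

(** * Curves and linear systems *)

Section Curves.
Context {R : realType}.
Implicit Types U V W : normedModType R.

Lemma is_derive_cvgP W (c : R -> W) (dc : W) :
  is_derive (0 : R) 1 c dc <-> (h^-1 *: (c h - c 0)) @[h --> (0:R)^'] --> dc.
Proof.
have E : (fun h : R => h^-1 *: ((c \o shift 0) (h *: 1) - c 0)) =
         (fun h => h^-1 *: (c h - c 0)).
  by apply/funext => h /=; rewrite addr0 [h *: 1]mulr1.
split=> [[cc <-]|cc].
  by have := cc; rewrite /derivable E /derive E; apply: cvgP.
have dcE : lim (h^-1 *: (c h - c 0) @[h --> (0:R)^']) = dc by exact: cvg_lim.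
by split; rewrite ?/derivable ?/derive E //; exact: cvgP cc.
Qed.

Lemma is_derive_cst_fun W (w : W) : is_derive (0 : R) 1 (fun=> w) 0.
Proof. exact: is_derive_cst. Qed.

Lemma is_derive_continuous W (c : R -> W) dc :
  is_derive (0 : R) 1 c dc -> c h @[h --> (0 : R)] --> c 0.
Proof. by move=> [/derivable1_diffP/differentiable_continuous]. Qed.

Lemma is_derive_scale W (k : R -> R^o) (c : R -> W) dk dc :
  is_derive (0 : R) 1 k dk -> is_derive (0 : R) 1 c dc ->
  is_derive (0 : R) 1 (fun t => k t *: c t) (k 0 *: dc + dk *: c 0).
Proof.
move=> [/derivable1_diffP kd <-] [/derivable1_diffP cd <-].
have [kcd _] := is_diff_scale kd cd.
by split; [exact: diff_derivable|rewrite derive_scale].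
Qed.

Lemma is_derive_entry q (c : R -> 'rV[R]_q) dc j :
  is_derive (0 : R) 1 c dc -> is_derive (0 : R) 1 (fun t => c t 0 j : R^o) (dc 0 j).
Proof.
move=> [/derivable1_diffP cd <-].
by split; [apply: diff_derivable; exact: differentiable_entry|exact: derive_entry].
Qed.

Lemma is_derive_sum_fun W n (c : 'I_n -> R -> W) dc :
  (forall i, is_derive (0 : R) 1 (c i) (dc i)) ->
  is_derive (0 : R) 1 (fun t => \sum_i c i t) (\sum_i dc i).
Proof.
move=> H; rewrite (_ : (fun t => _) = \sum_i c i); first exact: is_derive_sum.
by apply/funext => t; rewrite fct_sumE.
Qed.

Lemma cvg_sum_fun W n (f : 'I_n -> R -> W) (l : 'I_n -> W) :
  (forall j, f j h @[h --> (0 : R)] --> l j) ->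
  \sum_j f j h @[h --> (0 : R)] --> \sum_j l j.
Proof. by move=> fl; apply: (cvg_big (@add_continuous W)) => j _; exact: fl. Qed.

(** A product rule for a factor [a] that is merely continuous, possible because [N] vanishes at 0.
    It serves for the entries of an unknown whose differentiability is being proved. *)
Lemma is_derive_scale_vanish W (a : R -> R^o) (N : R -> W) dN :
  a h @[h --> (0 : R)] --> a 0 -> N 0 = 0 -> is_derive (0 : R) 1 N dN ->
  is_derive (0 : R) 1 (fun t => a t *: N t) (a 0 *: dN).
Proof.
move=> ac N0 /is_derive_cvgP dNc; apply/is_derive_cvgP.
rewrite (_ : (fun h => _) = fun h => a h *: (h^-1 *: (N h - N 0))).
  by apply: cvgZ => //; exact: cvg_within_filter.
by apply/funext => h; rewrite N0 scaler0 !subr0 !scalerA mulrC.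
Qed.

(** A predicate on bare functions, since maps such as w |-> 'D_(w, 0) f z are linear only where f is
    differentiable, that is for parameters near 0. Expansion in the basis is the form of linearity
    used below. *)
Definition linear_fun q W (L : 'rV[R]_q -> W) : Prop :=
  forall w, L w = \sum_j w 0 j *: L (delta_mx 0 j).

Lemma linear_fun_comp q m W (L : 'rV[R]_q -> W) (K : 'rV[R]_m -> 'rV[R]_q) :
  linear_fun L -> linear_fun K -> linear_fun (L \o K).
Proof.
move=> LL LK w; rewrite /= LL.
under [RHS]eq_bigr do rewrite LL scaler_sumr.
rewrite exchange_big /=; apply: eq_bigr => i _.
rewrite LK summxE scaler_suml; apply: eq_bigr => j _.
by rewrite mxE scalerA.
Qed.

Lemma derive_linear_fun q W V (f : V -> W) (i : 'rV[R]_q -> V) x :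
  differentiable f x -> linear_fun i -> linear_fun (fun w => 'D_(i w) f x).
Proof.
move=> df iL w; rewrite {1}iL derive_dir_sum//.
by apply: eq_bigr => j _; rewrite derive_dirZ.
Qed.

Lemma linear_fun_inl q V : linear_fun (fun w : 'rV[R]_q => (w, 0 : V)).
Proof.
move=> w; apply: injective_projections.
  rewrite (raddf_sum (@fst _ _)) /= {1}(row_sum_delta w).
  by apply: eq_bigr.
by rewrite (raddf_sum (@snd _ _)) /= big1// => j _; rewrite scaler0.
Qed.

Lemma linear_fun_inr q V : linear_fun (fun w : 'rV[R]_q => (0 : V, w)).
Proof.
move=> w; apply: injective_projections.
  by rewrite (raddf_sum (@fst _ _)) /= big1// => j _; rewrite scaler0.
rewrite (raddf_sum (@snd _ _)) /= {1}(row_sum_delta w).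
by apply: eq_bigr.
Qed.

(** Differentiability of [L] in t is asked for each fixed argument only; as finitely many basis
    vectors determine [L t], this gives the product rule without a norm on linear maps. *)
Lemma is_derive_linapp_basis q W (L : R -> 'rV[R]_q -> W) (dL : 'rV[R]_q -> W)
    (X : R -> 'rV[R]_q) dX :
  (\forall t \near (0 : R), linear_fun (L t)) ->
  (forall w, is_derive (0 : R) 1 (L ^~ w) (dL w)) -> is_derive (0 : R) 1 X dX ->
  is_derive (0 : R) 1 (fun t => L t (X t))
    (\sum_j (X 0 0 j *: dL (delta_mx 0 j) + dX 0 j *: L 0 (delta_mx 0 j))).
Proof.
move=> LL dLP XP; apply: (@near_eq_is_derive _ _ _
  (fun t => \sum_j X t 0 j *: L t (delta_mx 0 j))).
  by apply: filterS LL => t LLt; rewrite [RHS]LLt.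
apply: is_derive_sum_fun => j.
by apply: (@is_derive_scale _ (fun t => X t 0 j : R^o)) => //; exact: is_derive_entry.
Qed.

Lemma is_derive_linear_fun q W (L : R -> 'rV[R]_q -> W) (dL : 'rV[R]_q -> W) :
  (\forall t \near (0 : R), linear_fun (L t)) ->
  (forall w, is_derive (0 : R) 1 (L ^~ w) (dL w)) -> linear_fun dL.
Proof.
move=> LL dLP w; have [_ <-] := dLP w.
(* The product rule along the constant curve w expands [dL w] in the basis. *)
have [_ E] := is_derive_linapp_basis LL dLP (is_derive_cst_fun w).
rewrite [LHS]E; apply: eq_bigr => j _.
by rewrite mxE scale0r addr0.
Qed.

Lemma is_derive_linapp q W (L : R -> 'rV[R]_q -> W) (dL : 'rV[R]_q -> W)
    (X : R -> 'rV[R]_q) dX :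
  (\forall t \near (0 : R), linear_fun (L t)) ->
  (forall w, is_derive (0 : R) 1 (L ^~ w) (dL w)) -> is_derive (0 : R) 1 X dX ->
  is_derive (0 : R) 1 (fun t => L t (X t)) (dL (X 0) + L 0 dX).
Proof.
move=> LL dLP XP; apply: is_derive_eq (is_derive_linapp_basis LL dLP XP) _.
by rewrite (is_derive_linear_fun LL dLP) (nbhs_singleton LL dX) big_split.
Qed.

(* The velocity of a star-conjugate is only known through a linear equation
   with coefficients close to the identity; differentiating that equation needs
   no regularity of [A] in advance. *)
Lemma is_derive_linsolve q (L : R -> 'rV[R]_q -> 'rV[R]_q)
    (dL : 'rV[R]_q -> 'rV[R]_q) (A c : R -> 'rV[R]_q) dc :
  (\forall t \near (0 : R), linear_fun (L t)) -> (forall w, L 0 w = w) ->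
  (forall w, is_derive (0 : R) 1 (L ^~ w) (dL w)) -> is_derive (0 : R) 1 c dc ->
  (\forall t \near (0 : R), L t (A t) = c t) ->
  is_derive (0 : R) 1 A (dc - dL (c 0)).
Proof.
move=> LL L0 dLP cP LA.
have A0 : A 0 = c 0 by rewrite -(nbhs_singleton LA) L0.
pose N j t := L t (delta_mx 0 j) - delta_mx 0 j.
have N0 j : N j 0 = 0 by rewrite /N L0 subrr.
have NP j : is_derive (0 : R) 1 (N j) (dL (delta_mx 0 j)).
  rewrite -[dL _]subr0; apply: is_deriveB; exact: is_derive_cst_fun.
(* Fixed-point form of the equation: the corrections [N j] tend to 0, which bounds A near 0 and then
   makes it continuous. *)
have AE : \forall t \near (0 : R), A t = c t - \sum_j A t 0 j *: N j t.
  apply: filterS (filterI LL LA) => t [LLt LAt].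
  rewrite -LAt LLt /N -sumrB {1}(row_sum_delta (A t)); apply: eq_bigr => j _.
  by rewrite scalerBr opprB addrC subrK.
have Nc j : N j h @[h --> (0 : R)] --> (0 : 'rV[R]_q).
  by rewrite -(N0 j); exact: is_derive_continuous (NP j).
have entry_le (w : 'rV[R]_q) j : `|w 0 j| <= `|w|.
  by rewrite [leRHS]/Num.Def.normr/= mx_normrE (le_bigmax _ _ (0, j)).
(* Absorption constant: near 0 one has |A| <= |c| + |A| / 2 and |c| <= |c 0| + 1. *)
pose K := 2 * (`|c 0| + 1).
have bnd : \forall t \near (0 : R), `|A t| <= K.
  have Nsmall : \forall t \near (0 : R), \sum_j `|N j t| <= 1 / 2.
    have : \sum_j `|N j h| @[h --> (0 : R)] --> \sum_(j < q) `|0 : 'rV[R]_q|.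
      by apply: cvg_sum_fun => j; apply: cvg_norm.
    rewrite normr0 big1// => /cvgrPdist_le/(_ (1/2)).
    rewrite divr_gt0// => /(_ isT); apply: filterS => t.
    by rewrite sub0r normrN; apply: le_trans; exact: ler_norm.
  have cb : \forall t \near (0 : R), `|c t| <= `|c 0| + 1.
    have /cvgrPdist_le/(_ 1 ltr01) := is_derive_continuous cP.
    apply: filterS => t; rewrite distrC => H.
    by rewrite -[c t](subrK (c 0)) addrC (le_trans (ler_normD _ _))// lerD2l.
  apply: filterS (filterI AE (filterI Nsmall cb)) => t [AEt [Nt ct]].
  have : `|A t| <= `|c t| + `|A t| * (1 / 2).
    rewrite {1}AEt (le_trans (ler_normB _ _))// lerD2l.
    rewrite (le_trans (ler_norm_sum _ _ _))//.
    rewrite (le_trans _ (ler_wpM2l _ Nt))// mulr_sumr ler_sum// => j _.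
    by rewrite normrZ ler_wpM2r.
  rewrite /K; lra.
have Ac : A h @[h --> (0 : R)] --> A 0.
  have S0 : \sum_j A h 0 j *: N j h @[h --> (0 : R)] --> \sum_(j < q) (0 : 'rV[R]_q).
    apply: cvg_sum_fun => j; apply/norm_cvg0P.
    apply: (@squeeze_cvgr _ _ _ _ (fun=> 0) (fun h => K * `|N j h|)).
    - apply: filterS bnd => t At; rewrite normr_ge0 normrZ ler_wpM2r//.
      exact: le_trans (entry_le _ _) At.
    - exact: cvg_cst.
    - have Ncj : `|N j h| @[h --> (0 : R)] --> (0 : R).
        by rewrite -[X in _ --> X](@normr0 _ 'rV[R]_q); exact: cvg_norm.
      by have H := cvgMl_tmp (a := K) Ncj; rewrite mulr0 in H; exact: H.
  rewrite big1// in S0.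
  have H : c h - \sum_j A h 0 j *: N j h @[h --> (0 : R)] --> A 0.
    by rewrite A0 -[X in _ --> X]subr0; apply: cvgB S0; exact: is_derive_continuous cP.
  apply: cvg_trans H; apply: near_eq_cvg.
  by apply: filterS AE => t AEt; rewrite [RHS]AEt.
(* Continuity of the entries of A now suffices to differentiate the fixed-point form, because every
   [N j] vanishes at 0. *)
apply: (@near_eq_is_derive _ _ _ (fun t => c t - \sum_j A t 0 j *: N j t)).
  by apply: filterS AE => t AEt; rewrite -AEt.
have SP : is_derive (0 : R) 1 (fun t => \sum_j A t 0 j *: N j t)
    (\sum_j A 0 0 j *: dL (delta_mx 0 j)).
  apply: is_derive_sum_fun => j.
  apply: (@is_derive_scale_vanish _ (fun t => A t 0 j : R^o)) => //.
  apply: (@continuous_comp _ _ _ A (fun w : 'rV[R]_q => w 0 j)) => //.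
  exact: coord_continuous.
apply: is_derive_eq (is_deriveB cP SP) _.
by congr (_ - _); rewrite -A0 [RHS](is_derive_linear_fun LL dLP).
Qed.

(* The local inverse [k] of a unit curve is only assumed continuous in the
   parameter: its derivative comes from the equation [g * k = 1]. *)
Lemma is_derive_implicit q (f : R^o * 'rV[R]_q -> 'rV[R]_q) (y v0 : 'rV[R]_q)
    (k : R -> 'rV[R]_q) :
  differentiable f (0, v0) ->
  (forall t w, 'D_(t, w) f (0, v0) = t *: y + w) ->
  k 0 = v0 -> k h @[h --> (0 : R)] --> v0 ->
  (\forall t \near (0 : R), f (t, k t) = f (0, v0)) ->
  is_derive (0 : R) 1 k (- y).
Proof.
move=> df dfE k0 kc fk; apply/is_derive_cvgP; rewrite k0.
apply/cvgrPdist_le => eps e0.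
(* The bound 1 / 2 lets the increment w of k be absorbed, giving |w| <= |h| (2 |y| + 1); the other
   bound then turns eta (|h| + |w|) into at most eps |h|. *)
pose eta := Num.min (1 / 2) (eps / (2 * `|y| + 2)).
have den0 : 0 < 2 * `|y| + 2 by rewrite ltr_wpDl// mulr_ge0.
have eta0 : 0 < eta by rewrite lt_min !divr_gt0.
have eta1 : eta <= 1 / 2 by rewrite ge_min lexx.
have eta2 : eta * (2 * `|y| + 2) <= eps.
  by rewrite -ler_pdivlMr// ge_min lexx orbT.
have [d d0 dH] := differentiable_bound df eta0.
have kd : \forall h \near (0 : R), `|v0 - k h| < d by exact: (cvgrPdist_lt _ _).1 kc d d0.
have hd : \forall h \near (0 : R), `|h| < d by exact: nbhs0_lt.
rewrite near_withinE; apply: filterS (filterI fk (filterI kd hd)).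
move=> h [fkh [{}kd {}hd]] hN0.
set w := k h - v0.
have h0 : 0 < `|h| by rewrite normr_gt0.
have wd : `|((h : R^o), w)| < d.
  by rewrite prod_normE /= gt_max hd distrC kd.
have := dH _ wd; rewrite dfE.
have -> : ((h : R^o), w) + ((0 : R^o), v0) = ((h : R^o), k h).
  by rewrite /w; congr (_, _); rewrite /= ?addr0// subrK.
rewrite fkh subrr sub0r normrN => H.
have {}H : `|h *: y + w| <= eta * (`|h| + `|w|).
  apply: le_trans H _; rewrite ler_wpM2l ?(ltW eta0)// prod_normE /= ge_max.
  by rewrite lerDl lerDr !normr_ge0.
have w1 : `|w| <= `|h| * (2 * `|y| + 1).
  have : `|w| <= `|h *: y + w| + `|h| * `|y|.
    by rewrite -normrZ -{1}(addKr (h *: y) w) addrC ler_normB.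
  have := le_trans H (ler_wpM2r (addr_ge0 (normr_ge0 _) (normr_ge0 _)) eta1).
  lra.
rewrite -(ler_pM2l h0) -normrZ scalerBr scalerN scalerA mulfV// scale1r.
rewrite -opprD normrN (le_trans H)//.
apply: le_trans (_ : eta * (`|h| * (2 * `|y| + 2)) <= _).
  rewrite ler_wpM2l ?(ltW eta0)//; move: w1; lra.
by rewrite mulrCA ler_wpM2l.
Qed.

End Curves.

(** * Multiplication in a chart of the group *)

Lemma near_open (T U : topologicalType) (f : T -> U) (x : T) (B : set U) :
  {for x, continuous f} -> open B -> B (f x) -> \forall z \near x, B (f z).
Proof. by move=> fc oB Bf; exact: (fc _ (open_nbhs_nbhs (conj oB Bf))). Qed.

Lemma for_continuous_pair (T U V : topologicalType) (f : T -> U) (g : T -> V) x :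
  {for x, continuous f} -> {for x, continuous g} ->
  {for x, continuous (fun z => (f z, g z))}.
Proof. by move=> fc gc; exact: (cvg_pair fc gc). Qed.

Lemma for_continuous_comp (T U V : topologicalType) (f : T -> U) (g : U -> V) x :
  {for x, continuous f} -> {for f x, continuous g} ->
  {for x, continuous (fun z => g (f z))}.
Proof. exact: continuous_comp. Qed.

Lemma open_setI_preimage (T U : topologicalType) (A : set T) (f : T -> U)
    (B : set U) : open A -> (forall x, A x -> {for x, continuous f}) ->
  open B -> open (A `&` [set x | B (f x)]).
Proof.
move=> oA fc oB; rewrite openE => x [Ax Bfx].
by apply: filterI; [exact: open_nbhs_nbhs|exact: near_open (fc x Ax) oB Bfx].
Qed.

Lemma open_setX_prod (T U : topologicalType) (A : set T) (B : set U) :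
  open A -> open B -> open (A `*` B).
Proof.
move=> oA oB; rewrite openE => -[x y] [/= Ax By].
by exists (A, B) => //; split; exact: open_nbhs_nbhs.
Qed.

Section Chart.
Context {R : realType} {r : nat} {G : lieGroupType R r} (e : chart R r G).
Hypotheses (He : lie_atlas (s := G) e) (He1 : cdom e 1%g).
Implicit Types V W : normedModType R.

Lemma cmap_continuous g : cdom e g -> {for g, continuous (cmap e)}.
Proof.
move=> eg; have := cmap_cont (c := e).
by rewrite (continuous_open_subspace _ (open_cdom e)); apply; rewrite inE.
Qed.

Lemma cinv_continuous u : ccod e u -> {for u, continuous (cinv e)}.
Proof.
move=> eu; have := cinv_cont (c := e).
by rewrite (continuous_open_subspace _ (@open_ccod _ _ _ e)); apply; rewrite inE.
Qed.

Definition chart_mul (z : 'rV[R]_r * 'rV[R]_r) : 'rV[R]_r :=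
  cmap e (cinv e z.1 * cinv e z.2)%g.

Definition chart_mul_dom : set ('rV[R]_r * 'rV[R]_r) :=
  (ccod e `*` ccod e) `&` [set z | cdom e (cinv e z.1 * cinv e z.2)%g].

Local Notation m := chart_mul.
Local Notation e0 := (cmap e 1%g).

Lemma chart_mul_smooth : smooth_on chart_mul_dom m.
Proof. by have [_ /(_ e He)] := lie_mul_smooth e e He He. Qed.

Lemma chart_mul_continuous c d : ccod e c -> ccod e d ->
  {for (c, d), continuous
    (fun z : 'rV[R]_r * 'rV[R]_r => (cinv e z.1 * cinv e z.2)%g)}.
Proof.
move=> ec ed; have [H _] := lie_mul_smooth e e He He.
by apply: H.
Qed.

Lemma open_chart_mul_dom : open chart_mul_dom.
Proof.
apply: open_setI_preimage (open_cdom e).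
  exact: open_setX_prod (@open_ccod _ _ _ e) (@open_ccod _ _ _ e).
by move=> [c d] [ec ed]; exact: chart_mul_continuous.
Qed.

Lemma chart_mul_domP g h : cdom e g -> cdom e h -> cdom e (g * h)%g ->
  chart_mul_dom (cmap e g, cmap e h).
Proof.
move=> eg eh egh; split; first by split; exact: cmap_cod.
by rewrite /= !cmapK.
Qed.

Lemma chart_mul_diff g h : cdom e g -> cdom e h -> cdom e (g * h)%g ->
  differentiable m (cmap e g, cmap e h).
Proof.
by move=> eg eh egh; apply: smooth_on_diff chart_mul_smooth _; exact: chart_mul_domP.
Qed.

(* Away from [cdom e] the value of [cmap e] is arbitrary, hence the first two
   clauses. *)
Definition gdiff V (f : V -> G) (x : V) : Prop :=
  [/\ {for x, continuous f}, cdom e (f x)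
    & differentiable (fun z => cmap e (f z)) x].

Lemma gdiff_near V (f : V -> G) x : gdiff f x -> \forall z \near x, cdom e (f z).
Proof. by move=> [fc ef _]; exact: near_open fc (open_cdom e) ef. Qed.

Lemma gdiff_cst V (g : G) (x : V) : cdom e g -> gdiff (fun=> g) x.
Proof.
by move=> eg; split=> //; exact: cst_continuous.
Qed.

Lemma gdiff_ext V (f h : V -> G) x : (\forall z \near x, f z = h z) ->
  gdiff f x -> gdiff h x.
Proof.
move=> fh [fc ef df]; have fhx := nbhs_singleton fh; split.
- rewrite /prop_for /continuous_at -fhx; apply: cvg_trans fc.
  by apply: near_eq_cvg; apply: filterS fh => z ->.
- by rewrite -fhx.
- by apply: near_eq_differentiable df; apply: filterS fh => z ->.
Qed.

Lemma gdiff_comp V W (a : V -> W) (f : W -> G) x :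
  differentiable a x -> gdiff f (a x) -> gdiff (fun z => f (a z)) x.
Proof.
move=> da [fc ef df]; split=> //; last exact: (differentiable_comp da df).
exact: for_continuous_comp (differentiable_continuous da) fc.
Qed.

Lemma gdiff_cinv u : ccod e u -> gdiff (cinv e) u.
Proof.
move=> eu; split; [exact: cinv_continuous|exact: cinv_dom|].
apply: (@near_eq_differentiable _ _ _ id) => //.
by apply: filterS (open_nbhs_nbhs (conj (@open_ccod _ _ _ e) eu)) => z ez; rewrite cinvK.
Qed.

Lemma derive_cinv u w : ccod e u -> 'D_w (fun z => cmap e (cinv e z)) u = w.
Proof.
move=> eu; rewrite -[RHS](derive_id u w); apply: near_eq_derive.
by apply: filterS (open_nbhs_nbhs (conj (@open_ccod _ _ _ e) eu)) => z ez; rewrite cinvK.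
Qed.

(** The chart domain is not stable under products, so membership of the product at x is a
    hypothesis; near x it then follows by continuity. *)
Lemma gdiff_mul V (f h : V -> G) x : gdiff f x -> gdiff h x ->
  cdom e (f x * h x)%g ->
  gdiff (fun z => f z * h z)%g x /\
  forall v, 'D_v (fun z => cmap e (f z * h z)%g) x =
    'D_('D_v (fun z => cmap e (f z)) x, 'D_v (fun z => cmap e (h z)) x) m
      (cmap e (f x), cmap e (h x)).
Proof.
move=> gf gh efh; have [fc ef df] := gf; have [hc eh dh] := gh.
have nE : \forall z \near x,
    (cinv e (cmap e (f z)) * cinv e (cmap e (h z)) = f z * h z)%g.
  by apply: filterS (filterI (gdiff_near gf) (gdiff_near gh)) => z [ez ez']; rewrite !cmapK.
have dfh := differentiable_pair df dh.
have dm := chart_mul_diff ef eh efh.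
have nmE : \forall z \near x, m (cmap e (f z), cmap e (h z)) = cmap e (f z * h z)%g.
  by apply: filterS nE => z /= <-.
split; last first.
  move=> v; rewrite -(derive_pair v df dh) -(derive_comp v dfh dm).
  by apply: esym; apply: near_eq_derive.
(* Continuity of the multiplication of [G] is available only through inverse charts, so the product
   is rewritten as a composite with them. *)
have mc : {for x, continuous (fun z =>
    cinv e (cmap e (f z)) * cinv e (cmap e (h z)))%g}.
  apply: (@for_continuous_comp _ _ _ (fun z => (cmap e (f z), cmap e (h z)))
    (fun w => cinv e w.1 * cinv e w.2)%g x).
    exact: differentiable_continuous.
  by apply: chart_mul_continuous; exact: cmap_cod.
have [] := @gdiff_ext _ _ (fun z => (f z * h z)%g) x nE.
  split=> //; first by rewrite !cmapK.
  exact: differentiable_comp dfh dm.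
by [].
Qed.

Lemma gdiff_smooth_into V (U : set V) (f : V -> G) x : 
  smooth_into (lie_atlas (s := G)) U f -> U x -> cdom e (f x) -> gdiff f x.
Proof.
move=> [fc fs] Ux ef; split=> //; first exact: fc.
by apply: smooth_on_diff (fs e He) _.
Qed.

Lemma chart_mul_idl_derive u w : ccod e u -> 'D_(0, w) m (e0, u) = w.
Proof.
move=> eu; have e1 := He1; have ei := cinv_dom eu.
have dm : differentiable m (e0, u).
  by rewrite -(cinvK eu); apply: chart_mul_diff => //; rewrite mul1g.
have E : 'D_w (fun z => m (e0, z)) u = 'D_(0, w) m (e0, u).
  have dp : differentiable (fun z : 'rV[R]_r => (e0, z)) u.
    by apply: differentiable_pair; [exact: differentiable_cst|].
  rewrite (derive_comp w dp dm); congr ('D_ _ m _).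
  by rewrite derive_pair// ?derive_cst ?derive_id//; exact: differentiable_cst.
rewrite -E -[RHS](derive_cinv w eu); apply: near_eq_derive.
by apply: filterE => z; rewrite /m /= cmapK// mul1g.
Qed.

Lemma chart_mul_idr_derive u w : ccod e u -> 'D_(w, 0) m (u, e0) = w.
Proof.
move=> eu; have e1 := He1; have ei := cinv_dom eu.
have dm : differentiable m (u, e0).
  by rewrite -(cinvK eu); apply: chart_mul_diff => //; rewrite mulg1.
have E : 'D_w (fun z => m (z, e0)) u = 'D_(w, 0) m (u, e0).
  have dp : differentiable (fun z : 'rV[R]_r => (z, e0)) u.
    by apply: differentiable_pair; [|exact: differentiable_cst].
  rewrite (derive_comp w dp dm); congr ('D_ _ m _).
  by rewrite derive_pair// ?derive_cst ?derive_id//; exact: differentiable_cst.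
rewrite -E -[RHS](derive_cinv w eu); apply: near_eq_derive.
by apply: filterE => z; rewrite /m /= [cinv e e0]cmapK// mulg1.
Qed.

End Chart.

(** * The velocity of a conjugate and the Lie bracket *)

Section Conjugation.
Context {R : realType} {r : nat} {G : lieGroupType R r} (e : chart R r G).
Hypotheses (He : lie_atlas (s := G) e) (He1 : cdom e 1%g).

Local Notation m := (chart_mul e).
Local Notation e0 := (cmap e 1%g).

Let ce0 : ccod e e0 := cmap_cod He1.

Lemma gdiff_conj (a K : 'rV[R]_r -> G) : gdiff e a e0 -> gdiff e K e0 ->
  (a e0 * K e0 = 1)%g -> gdiff e (fun b => a b * cinv e b * K b)%g e0.
Proof.
move=> ga gK aK; have [_ ea _] := ga.
have ci : cinv e e0 = 1%g by exact: cmapK.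
have eac : cdom e (a e0 * cinv e e0)%g by rewrite ci mulg1.
have [gp _] := gdiff_mul He ga (gdiff_cinv ce0) eac.
have eacK : cdom e (a e0 * cinv e e0 * K e0)%g by rewrite ci mulg1 aK.
by have [] := gdiff_mul He gp gK eacK.
Qed.

(* [Q = a b K] satisfies [Q J = a b]; comparing the two derivatives gives a
   linear equation for the derivative of [Q] that involves neither [K] nor the
   inverse of [G]. *)
Lemma derive_conj (a K J : 'rV[R]_r -> G) (w : 'rV[R]_r) :
  gdiff e a e0 -> gdiff e K e0 -> gdiff e J e0 ->
  (a e0 * K e0 = 1)%g -> J e0 = a e0 ->
  (\forall b \near e0, (a b * cinv e b * K b) * J b = a b * cinv e b)%g ->
  'D_('D_w (fun b => cmap e (a b * cinv e b * K b)%g) e0, 'D_w (fun b => cmap e (J b)) e0)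
    m (e0, cmap e (a e0)) =
  'D_w (fun b => cmap e (a b)) e0 + 'D_(0, w) m (cmap e (a e0), e0).
Proof.
move=> ga gK gJ aK Ja QJ; have [_ ea _] := ga.
have ci : cinv e e0 = 1%g by exact: cmapK.
have eac : cdom e (a e0 * cinv e e0)%g by rewrite ci mulg1.
have gQ := gdiff_conj ga gK aK.
have [gp Dp] := gdiff_mul He ga (gdiff_cinv ce0) eac.
have Q0 : (a e0 * cinv e e0 * K e0 = 1)%g by rewrite ci mulg1.
have eQJ : cdom e (a e0 * cinv e e0 * K e0 * J e0)%g by rewrite Q0 mul1g Ja.
have [_ DQ] := gdiff_mul He gQ gJ eQJ.
have := DQ w; rewrite Q0 Ja => <-.
have -> : 'D_w (fun b => cmap e (a b * cinv e b * K b * J b)%g) e0 =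
    'D_w (fun b => cmap e (a b * cinv e b)%g) e0.
  by apply: near_eq_derive; apply: filterS QJ => b ->.
rewrite Dp ci (derive_cinv w ce0) derive_pair_split.
  by congr (_ + _); apply: chart_mul_idr_derive => //; exact: cmap_cod.
by apply: chart_mul_diff => //; rewrite mulg1.
Qed.

(** As [Q] does not involve [h], the velocity depends on [h] only through x. This is what makes Ad
    independent of the chosen curve. *)
Lemma velocity_subst (Q : 'rV[R]_r -> G) (h F : R -> G) (x : 'rV[R]_r) :
  gdiff e Q e0 -> has_velocity e h x ->
  (\forall t \near (0 : R), F t = Q (cmap e (h t))) ->
  is_derive (0 : R) 1 (fun t => cmap e (F t)) ('D_x (fun b => cmap e (Q b)) e0).
Proof.
move=> [_ _ dQ] [h0 hx] FQ.
apply: (@near_eq_is_derive _ _ _ (fun t => cmap e (Q (cmap e (h t))))).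
  by apply: filterS FQ => t ->.
have := is_derive_comp hx (g := fun b => cmap e (Q b)).
by rewrite h0; apply.
Qed.

Section CoordinateCurve.
Variables (c : R -> 'rV[R]_r) (y : 'rV[R]_r).
Hypotheses (c0 : c 0 = e0) (cy : is_derive (0 : R) 1 c y).

Let near_mul_dom_l : \forall t \near (0 : R), chart_mul_dom e (e0, c t).
Proof.
apply: (@near_open _ _ (fun t => (e0, c t))).
- by apply: for_continuous_pair; [exact: cst_continuous|exact: is_derive_continuous cy].
- exact: open_chart_mul_dom.
- by rewrite c0; apply: chart_mul_domP => //; rewrite mulg1.
Qed.

Let near_mul_dom_r : \forall t \near (0 : R), chart_mul_dom e (c t, e0).
Proof.
apply: (@near_open _ _ (fun t => (c t, e0))).
- by apply: for_continuous_pair; [exact: is_derive_continuous cy|exact: cst_continuous].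
- exact: open_chart_mul_dom.
- by rewrite c0; apply: chart_mul_domP => //; rewrite mulg1.
Qed.

Let dom00 : chart_mul_dom e (e0, e0).
Proof. by apply: chart_mul_domP => //; rewrite mulg1. Qed.

Lemma linear_mul_l : \forall t \near (0 : R),
  linear_fun (fun w => 'D_(w, 0) m (e0, c t)).
Proof.
apply: filterS near_mul_dom_l => t mt.
apply: derive_linear_fun; last exact: linear_fun_inl.
exact: smooth_on_diff (chart_mul_smooth He) mt.
Qed.

Lemma linear_mul_r : \forall t \near (0 : R),
  linear_fun (fun w => 'D_(0, w) m (c t, e0)).
Proof.
apply: filterS near_mul_dom_r => t mt.
apply: derive_linear_fun; last exact: linear_fun_inr.
exact: smooth_on_diff (chart_mul_smooth He) mt.
Qed.

Lemma is_derive_mul_l w : is_derive (0 : R) 1 (fun t => 'D_(w, 0) m (e0, c t))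
  ('D_(0, y) ('D_(w, 0) m) (e0, e0)).
Proof.
have := is_derive_comp (is_derive_pair (is_derive_cst_fun e0) cy) (g := 'D_(w, 0) m).
rewrite c0; apply.
exact: smooth_on_diff (smooth_on_derive _ (chart_mul_smooth He)) dom00.
Qed.

Lemma is_derive_mul_r w : is_derive (0 : R) 1 (fun t => 'D_(0, w) m (c t, e0))
  ('D_(y, 0) ('D_(0, w) m) (e0, e0)).
Proof.
have := is_derive_comp (is_derive_pair cy (is_derive_cst_fun e0)) (g := 'D_(0, w) m).
rewrite c0; apply.
exact: smooth_on_diff (smooth_on_derive _ (chart_mul_smooth He)) dom00.
Qed.

End CoordinateCurve.

(** The antisymmetrized mixed second-order term of the group law at the unit, as for a formal group
    law. Each term has the order of differentiation in which it arises, from D_2 m(c, 1) and from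
    D_1 m(1, c) along a curve c. *)
Definition chart_br (y w : 'rV[R]_r) : 'rV[R]_r :=
  'D_(y, 0) ('D_(0, w) m) (e0, e0) - 'D_(0, y) ('D_(w, 0) m) (e0, e0).

(** Conjugation by exp(t y) is the case of [derive_conj] with [a], [K] and [J] constant: with c_t
    the coordinates of exp(t y), it gives D_1 m(1, c_t) A_t = D_2 m(c_t, 1) w, which is
    differentiated like the equation of the local group. *)
Lemma lie_brE (expG : 'rV[R]_r -> G) (y w : 'rV[R]_r) :
  is_lie_exp e expG -> lie_br e expG y w = chart_br y w.
Proof.
move=> expP; have [[exp_cont _] expD vel_y] := expP y.
have [_ _ vel_w] := expP w; have [y0 cy] := vel_y.
have expc : {for (0 : R^o), continuous (fun t : R^o => expG ((t : R) *: y))} by exact: exp_cont.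
have near_exp : \forall t \near (0 : R), cdom e (expG (t *: y)).
  by apply: near_open expc (open_cdom e) _; rewrite y0.
(* To differentiate the conjugation, the inverse of exp(t y) must lie in the chart domain too; being
   exp(- t y), it does for t near 0. *)
have near_expN : \forall t \near (0 : R), cdom e (expG ((- t) *: y)).
  apply: (@near_open _ _ (fun t : R => expG ((- t) *: y)) 0 _ _ (open_cdom e)).
    apply: (@for_continuous_comp _ _ _ (fun t : R => - t) (fun t : R => expG (t *: y)) 0).
      exact: opp_continuous.
    by rewrite oppr0.
  by rewrite oppr0 y0.
have expV t : (expG (t *: y) * expG ((- t) *: y) = 1)%g by rewrite -expD subrr.
have vel_c0 : cmap e (expG (0 *: y)) = e0 by rewrite y0.
suff E : is_derive (0 : R) 1 (fun t : R => lie_Ad e expG (expG (t *: y)) w)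
    (chart_br y w) by rewrite /lie_br derive1E; exact: derive_val.
have cw := is_derive_mul_r vel_c0 cy w.
apply: is_derive_eq (is_derive_linsolve (linear_mul_l vel_c0 cy) _
  (is_derive_mul_l vel_c0 cy) cw _) _.
- by move=> v; rewrite vel_c0; exact: (chart_mul_idr_derive He He1 v ce0).
- apply: filterS (filterI near_exp near_expN) => t [et etN].
  set g := expG (t *: y) in et *; have gV : (g^-1 = expG ((- t) *: y))%g.
    by apply: mulg1_eq; exact: expV.
  have gg : gdiff e (fun=> g) e0 by exact: gdiff_cst.
  have gg' : gdiff e (fun=> g^-1)%g e0 by apply: gdiff_cst; rewrite gV.
  have AdE : lie_Ad e expG g w = 'D_w (fun b => cmap e (g * cinv e b * g^-1)%g) e0.
    rewrite /lie_Ad /velocity derive1E; apply: derive_val.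
    apply: (@velocity_subst (fun b => g * cinv e b * g^-1)%g _ _ _ _ vel_w).
      by apply: gdiff_conj => //; rewrite mulgV.
    have [[w_cont _] _ [w0 _]] := expP w.
    have wc : {for (0 : R^o), continuous (fun t : R^o => expG ((t : R) *: w))} by exact: w_cont.
    have : \forall t \near (0 : R), cdom e (expG (t *: w)).
      by apply: near_open wc (open_cdom e) _; rewrite w0.
    by apply: filterS => u eu; rewrite cmapK.
  have := @derive_conj (fun=> g) (fun=> g^-1)%g (fun=> g) w gg gg' gg.
  rewrite -AdE !derive_cst add0r; apply=> //; first by rewrite mulgV.
  by apply: filterE => b; rewrite mulgVK.
- by rewrite vel_c0 /chart_br (chart_mul_idl_derive He He1 w ce0).
Qed.

End Conjugation.

(** * The action in a chart *)

Section Action.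
Context {R : realType} {p r : nat} {G : lieGroupType R r} (e : chart R r G).
Hypotheses (He : lie_atlas (s := G) e) (He1 : cdom e 1%g).
Variables (sd : action_side) (M : set 'rV[R]_p) (D : set (G * 'rV[R]_p)).
Variable act : G -> 'rV[R]_p -> 'rV[R]_p.
Hypotheses (HM : open M) (Hact : local_action sd M D act).

Local Notation m := (chart_mul e).
Local Notation e0 := (cmap e 1%g).

Let ce0 : ccod e e0 := cmap_cod He1.

Definition chart_act (z : 'rV[R]_r * 'rV[R]_p) : 'rV[R]_p := act (cinv e z.1) z.2.

Definition chart_act_dom : set ('rV[R]_r * 'rV[R]_p) :=
  [set z | ccod e z.1 /\ D (cinv e z.1, z.2)].

Local Notation al := chart_act.

Lemma chart_act_smooth : smooth_on chart_act_dom al.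
Proof. exact: act_smooth Hact e He. Qed.

Lemma chart_act_dom0 z : M z -> chart_act_dom (e0, z).
Proof. by move=> Mz; split=> //=; rewrite cmapK//; exact: act_dom1 Hact _ Mz. Qed.

Lemma chart_act_diff0 z : M z -> differentiable al (e0, z).
Proof. by move=> Mz; apply: smooth_on_diff chart_act_smooth (chart_act_dom0 Mz). Qed.

Lemma differentiable_inl z0 (b : 'rV[R]_r) : differentiable (fun b => (b, z0 : 'rV[R]_p)) b.
Proof. by apply: differentiable_pair => //; exact: differentiable_cst. Qed.

Lemma derive_inl z0 (b w : 'rV[R]_r) : 'D_w (fun b => (b, z0 : 'rV[R]_p)) b = (w, 0).
Proof. by rewrite derive_pair// ?derive_id ?derive_cst//; exact: differentiable_cst. Qed.

Lemma derive_chart_act_l z w : M z ->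
  differentiable (fun b => al (b, z)) e0 /\
  'D_w (fun b => al (b, z)) e0 = 'D_(w, 0) al (e0, z).
Proof.
move=> Mz; have dal := chart_act_diff0 Mz; split.
  exact: (differentiable_comp (differentiable_inl z e0) dal).
by rewrite (derive_comp w (differentiable_inl z e0) dal) derive_inl.
Qed.

Variables (expG : 'rV[R]_r -> G) (v : r.-tuple 'rV[R]_r).
Hypotheses (HexpG : is_lie_exp e expG) (Hv : basis_of fullv v).

Lemma exp_continuous0 w : {for (0 : R), continuous (fun t : R => expG (t *: w))}.
Proof. by have [[H _] _ _] := HexpG w; exact: H. Qed.

Lemma inf_fieldE w z : M z -> inf_field expG act w z = 'D_(w, 0) al (e0, z).
Proof.
move=> Mz; have [_ _ [w0 cw]] := HexpG w.
have [dal <-] := derive_chart_act_l w Mz.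
rewrite /inf_field derive1E; apply: derive_val.
apply: (@near_eq_is_derive _ _ _ (fun t : R => al (cmap e (expG (t *: w)), z))).
  have : \forall t \near (0 : R), cdom e (expG (t *: w)).
    apply: (@near_open _ _ (fun t : R => expG (t *: w)) 0 _
      (exp_continuous0 (w := w)) (open_cdom e)).
    by rewrite w0.
  by apply: filterS => t et; rewrite /chart_act /= cmapK.
have := is_derive_comp cw (g := fun b => al (b, z)).
by rewrite w0; apply.
Qed.

(** The differential of the action is linear in the direction, so the basis [v] disappears from the
    fundamental field. *)
Lemma rhoE x z : M z -> rho expG act v x z = 'D_(x z, 0) al (e0, z).
Proof.
move=> Mz; have dal := chart_act_diff0 Mz; rewrite /rho.
under eq_bigr do rewrite inf_fieldE//.
rewrite {2}(coord_basis Hv (memvf (x z))).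
have -> : (\sum_(i < r) coord v i (x z) *: v`_i, 0 : 'rV[R]_p) =
    \sum_(i < r) coord v i (x z) *: (v`_i, 0).
  apply: injective_projections.
    by rewrite (raddf_sum (@fst _ _)).
  by rewrite (raddf_sum (@snd _ _)) /= big1// => j _; rewrite scaler0.
rewrite derive_dir_sum//; apply: eq_bigr => j _.
by rewrite (tnth_nth 0) (derive_dirZ (coord v j (x z)) (v`_j, 0) dal).
Qed.

Lemma lie_derivE x y z : M z -> differentiable y z ->
  lie_deriv expG act v x y z = 'D_('D_(x z, 0) al (e0, z)) y z.
Proof.
move=> Mz dy; rewrite /lie_deriv rhoE//; set w := 'D_(x z, 0) al (e0, z).
rewrite [RHS](coord_basis Hv (memvf _)); apply: eq_bigr => j _.
rewrite (tnth_nth 0); congr (_ *: _).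
pose c : {linear 'rV[R]_r -> R^o} := coord v j.
(* A linear form on rows is a finite combination of entries. *)
have cc : continuous c.
  have -> : (c : 'rV[R]_r -> R^o) = (fun w : 'rV[R]_r => \sum_i w 0 i *: c (delta_mx 0 i)).
    apply/funext => u; rewrite {1}(row_sum_delta u) linear_sum.
    by apply: eq_bigr => i _; rewrite linearZ.
  apply: (@continuous_big R^o _ _ _ xpredT (@add_continuous R^o)) => i _ u.
  have ci : {for u, continuous (fun w : 'rV[R]_r => w 0 i)} by exact: coord_continuous.
  by apply: (cvgZ ci); exact: cvg_cst.
exact: (derive_linear_comp (g := c)).
Qed.

End Action.

(** * Unit curves *)

Section UnitCurve.
Context {R : realType} {p r : nat} {G : lieGroupType R r} (e : chart R r G).
Hypotheses (He : lie_atlas (s := G) e) (He1 : cdom e 1%g).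
Variables (sd : action_side) (M : set 'rV[R]_p) (D : set (G * 'rV[R]_p)).
Variable act : G -> 'rV[R]_p -> 'rV[R]_p.
Hypotheses (HM : open M) (Hact : local_action sd M D act).

Local Notation m := (chart_mul e).
Local Notation e0 := (cmap e 1%g).
Local Notation al := (chart_act e act).

Let ce0 : ccod e e0 := cmap_cod He1.

Lemma derive_inr_comp (W : normedModType R) (f : R^o * 'rV[R]_p -> W) t s w :
  differentiable f (t, s) ->
  differentiable (fun z => f (t, z)) s /\
  'D_w (fun z => f (t, z)) s = 'D_(0, w) f (t, s).
Proof.
move=> df.
have di : differentiable (fun z : 'rV[R]_p => (t, z)) s.
  by apply: differentiable_pair => //; exact: differentiable_cst.
split; first exact: (differentiable_comp di df).
by rewrite (derive_comp w di df) derive_pair ?derive_id ?derive_cst.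
Qed.

(** [is_star_Ad] demands that a curve with velocity [x] exist. The affine segment e0 + t x(z) of the
    chart is one, on the open set where it stays in [ccod e], which contains {0} x M. *)
Lemma exists_unit_curve (x : 'rV[R]_p -> 'rV[R]_r) :
  smooth_on M x -> exists h, unit_curve e M h x.
Proof.
move=> xM; exists (fun t z => cinv e (e0 + t *: x z)).
pose S : set (R^o * 'rV[R]_p) := setT `*` M.
pose f (z : R^o * 'rV[R]_p) : 'rV[R]_r := e0 + z.1 *: x z.2.
have oS : open S by exact: open_setX_prod openT HM.
have fS : smooth_on S f.
  apply/smooth_onP => n; apply: Cn_add => //; first exact: Cn_cst.
  apply: Cn_scale => //; first exact: Cn_fst.
  apply: (Cn_comp_row (B := M)) => //; [by move=> z []|exact: Cn_snd|].
  exact: (smooth_onP _ _).1.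
have fc z : S z -> {for z, continuous f}.
  by move=> Sz; exact: differentiable_continuous (smooth_on_diff fS Sz).
have oW := open_setI_preimage oS fc (@open_ccod _ _ _ e).
exists (S `&` [set z | ccod e (f z)]); split=> //.
- by move=> z Mz; split=> //=; rewrite /f scale0r addr0.
- have hc z : (S `&` [set z | ccod e (f z)]) z -> {for z, continuous (fun z => cinv e (f z))}.
    move=> [Sz ez]; apply: for_continuous_comp (fc z Sz) _.
    exact: cinv_continuous ez.
  split=> // c Hc.
  (* Read in another chart [c], the curve is the segment followed by the transition map from [e] to
     [c]. *)
  have [_ /(_ e c He Hc) tr] := lie_atlasP (s := G).
  apply/smooth_onP => n.
  apply: (@Cn_comp_row _ _ _ _ _ _ (ccod e `&` [set u | cdom c (cinv e u)])
    f (fun u => cmap c (cinv e u))).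
  + exact: open_setI_preimage oW hc (open_cdom c).
  + by move=> z [[Sz ez] cz].
  + by apply: (@Cn_sub _ _ _ _ _ S); [move=> z [[]]|exact: (smooth_onP _ _).1].
  + exact: (smooth_onP _ _).1.
- move=> z Mz; split; first by rewrite scale0r addr0 cmapK.
  have near_ccod : \forall t \near (0 : R), ccod e (e0 + t *: x z).
    apply: (@near_open _ _ (fun t : R => e0 + t *: x z) 0 _ _ (@open_ccod _ _ _ e)).
      have [/derivable1_diffP/differentiable_continuous + _] := is_derive_line (x z) e0 (0 : R).
      by under [X in {for _, continuous X} -> _]funext do rewrite addrC.
    by rewrite scale0r addr0.
  apply: (@near_eq_is_derive _ _ _ (fun t : R => t *: x z + e0)); last exact: is_derive_line.
  by apply: filterS near_ccod => t et; rewrite cinvK// addrC.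
Qed.

Variables (g : R -> 'rV[R]_p -> G) (y : 'rV[R]_p -> 'rV[R]_r).
Variable W : set (R^o * 'rV[R]_p).
Hypotheses (oW : open W) (W0 : forall s, M s -> W (0, s)).
Hypothesis gs : smooth_into (lie_atlas (s := G)) W
  (fun z : R^o * 'rV[R]_p => g z.1 z.2).
Hypothesis gv : forall s, M s -> has_velocity e (fun t => g t s) (y s).

Definition curve_dom : set (R^o * 'rV[R]_p) := W `&` [set z | cdom e (g z.1 z.2)].
Definition chart_curve (z : R^o * 'rV[R]_p) : 'rV[R]_r := cmap e (g z.1 z.2).

Local Notation u := chart_curve.

Lemma open_curve_dom : open curve_dom.
Proof.
apply: (@open_setI_preimage _ _ _ (fun z : R^o * 'rV[R]_p => g z.1 z.2)) oW _ (open_cdom e).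
by case: gs.
Qed.

Lemma chart_curve_smooth : smooth_on curve_dom u.
Proof. by case: gs => _; apply. Qed.

Lemma curve0 s : M s -> g 0 s = 1%g.
Proof. by case/gv. Qed.

Lemma curve_dom0 s : M s -> curve_dom (0, s).
Proof. by move=> Ms; split; [exact: W0|rewrite /= curve0]. Qed.

Lemma curve_continuous z : W z ->
  {for z, continuous (fun z : R^o * 'rV[R]_p => g z.1 z.2)}.
Proof. by case: gs => gc _; exact: gc. Qed.

Lemma gdiff_curve z : curve_dom z -> gdiff e (fun z : R^o * 'rV[R]_p => g z.1 z.2) z.
Proof. by move=> [Wz ez]; exact: gdiff_smooth_into gs Wz ez. Qed.

Lemma chart_curve_diff z : curve_dom z -> differentiable u z.
Proof. exact: smooth_on_diff chart_curve_smooth. Qed.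

Lemma near_M s : M s -> \forall z \near s, M z.
Proof. by move=> Ms; exact: open_nbhs_nbhs. Qed.

Lemma derive_curve_t s : M s -> 'D_(1, 0) u (0, s) = y s.
Proof.
move=> Ms; have [_ [_ <-]] := gv Ms.
have du := chart_curve_diff (curve_dom0 Ms).
have cP : is_derive (0 : R) 1 (fun t : R => ((t : R^o), s)) (1, 0).
  exact: is_derive_pair.
by have [_ <-] := is_derive_comp cP du.
Qed.

Lemma derive_curve_s s w : M s -> 'D_(0, w) u (0, s) = 0.
Proof.
move=> Ms; have du := chart_curve_diff (curve_dom0 Ms).
have [_ <-] := derive_inr_comp w du; rewrite -[RHS](derive_cst e0 s w).
apply: near_eq_derive; apply: filterS (near_M Ms) => z Mz.
by rewrite /chart_curve /= curve0.
Qed.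

Section AlongPath.
Variables (q : R -> 'rV[R]_p) (dq s : 'rV[R]_p).
Hypotheses (Ms : M s) (q0 : q 0 = s) (qP : is_derive (0 : R) 1 q dq).

Let tq : is_derive (0 : R) 1 (fun t => ((t : R^o), q t)) (1, dq).
Proof. exact: is_derive_pair. Qed.

Lemma path_continuous : {for (0 : R), continuous q}.
Proof. exact: is_derive_continuous qP. Qed.

Lemma near_path_M : \forall t \near (0 : R), M (q t).
Proof. by apply: near_open path_continuous HM _; rewrite q0. Qed.

Lemma near_path_curve_dom : \forall t \near (0 : R), curve_dom ((t : R^o), q t).
Proof.
apply: (@near_open _ _ (fun t => ((t : R^o), q t)) 0 _ _ open_curve_dom).
  exact: is_derive_continuous tq.
by rewrite q0; exact: curve_dom0.
Qed.

(** The motion of the point contributes nothing: g_0 is constant on [M], so only the derivative in t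
    at s survives. *)
Lemma is_derive_curve : is_derive (0 : R) 1 (fun t => u ((t : R^o), q t)) (y s).
Proof.
have du := chart_curve_diff (curve_dom0 Ms).
have := is_derive_comp tq (g := u); rewrite q0 => /(_ du) H.
apply: is_derive_eq H _.
by rewrite (derive_pair_split _ _ du) derive_curve_t// derive_curve_s// addr0.
Qed.

Lemma chart_curve0 : u (0, q 0) = e0.
Proof. by rewrite q0 /chart_curve /= curve0. Qed.

(* The derivative at [b = 1] of [b |-> g_t (b . q_t)] in the direction [w]. *)
Definition transport (t : R) (w : 'rV[R]_r) : 'rV[R]_r :=
  'D_(0, 'D_(w, 0) al (e0, q t)) u ((t : R^o), q t).

Lemma linear_transport : \forall t \near (0 : R), linear_fun (transport t).
Proof.
apply: filterS (filterI near_path_M near_path_curve_dom) => t [Mt ct].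
apply: (linear_fun_comp (L := fun z => 'D_(0, z) u ((t : R^o), q t))
  (K := fun w => 'D_(w, 0) al (e0, q t))).
  exact: derive_linear_fun (chart_curve_diff ct) (@linear_fun_inr _ _ _).
exact: derive_linear_fun (chart_act_diff0 He He1 Hact Mt) (@linear_fun_inl _ _ _).
Qed.

Lemma transport0 w : transport 0 w = 0.
Proof. by rewrite /transport q0 derive_curve_s. Qed.

Lemma is_derive_transport w : differentiable y s ->
  is_derive (0 : R) 1 (transport ^~ w) ('D_('D_(w, 0) al (e0, s)) y s).
Proof.
move=> dy.
(* The derivative along (1, dq) splits. The part in dq is zero because D_(0, z) u vanishes on {0} x
   M; in the other part, exchanging derivatives leaves D_(1, 0) u on {0} x M, which is y. *)
have dE z : is_derive (0 : R) 1 (fun t => 'D_(0, z) u ((t : R^o), q t)) ('D_z y s).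
  have dzu := smooth_on_diff
    (smooth_on_derive ((0, z) : R^o * 'rV[R]_p) chart_curve_smooth) (curve_dom0 Ms).
  have := is_derive_comp tq (g := 'D_(0, z) u); rewrite q0 => /(_ dzu) H.
  apply: is_derive_eq H _; rewrite (derive_pair_split _ _ dzu).
  have -> : 'D_(0, dq) ('D_(0, z) u) (0, s) = 0.
    have [_ <-] := derive_inr_comp dq dzu.
    rewrite -[RHS](derive_cst (0 : 'rV[R]_r) s dq).
    apply: near_eq_derive; apply: filterS (near_M Ms) => z' Mz'.
    exact: derive_curve_s.
  have dtu := smooth_on_diff
    (smooth_on_derive ((1, 0) : R^o * 'rV[R]_p) chart_curve_smooth) (curve_dom0 Ms).
  rewrite (derive_comm ((0, z) : R^o * 'rV[R]_p) ((1, 0) : R^o * 'rV[R]_p)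
    open_curve_dom (curve_dom0 Ms) chart_curve_smooth).
  have [_ <-] := derive_inr_comp z dtu; rewrite addr0.
  apply: near_eq_derive; apply: filterS (near_M Ms) => z' Mz'.
  exact: derive_curve_t.
have dal := chart_act_diff0 He He1 Hact Ms.
have sal := chart_act_smooth He Hact.
have dV : is_derive (0 : R) 1 (fun t => 'D_(w, 0) al (e0, q t))
    ('D_(0, dq) ('D_(w, 0) al) (e0, s)).
  have := is_derive_comp (is_derive_pair (is_derive_cst_fun e0) qP) (g := 'D_(w, 0) al).
  rewrite q0; apply.
  exact: smooth_on_diff (smooth_on_derive _ sal) (chart_act_dom0 He1 Hact Ms).
have LE : \forall t \near (0 : R), linear_fun (fun z => 'D_(0, z) u ((t : R^o), q t)).
  apply: filterS near_path_curve_dom => t ct.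
  exact: derive_linear_fun (chart_curve_diff ct) (@linear_fun_inr _ _ _).
(* The velocity of the fundamental field along q is fed to D_(0, .) u at (0, s), which is zero. *)
apply: is_derive_eq (is_derive_linapp LE dE dV) _.
by rewrite q0 derive_curve_s// addr0.
Qed.

End AlongPath.

End UnitCurve.

(** * The bracket of the local group *)

(** The limit is over full neighbourhoods, which contain x itself. Applied to the closeness of [k]
    to the unit section, it yields k_0 = 1. *)
Lemma hausdorff_cvg_at (T U : topologicalType) (f : T -> U) (x : T) (l : U) :
  hausdorff_space U -> f @ x --> l -> f x = l.
Proof.
move=> hU fl; apply: hU => A B Afx Bl.
by exists (f x); split; [exact: nbhs_singleton|exact: nbhs_singleton (fl B Bl)].
Qed.

Section Bracket.
Context {R : realType} {p r : nat} {G : lieGroupType R r} (e : chart R r G).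
Hypotheses (He : lie_atlas (s := G) e) (He1 : cdom e 1%g).
Variables (sd : action_side) (M : set 'rV[R]_p) (D : set (G * 'rV[R]_p)).
Variable act : G -> 'rV[R]_p -> 'rV[R]_p.
Hypotheses (HM : open M) (Hact : local_action sd M D act).

Local Notation m := (chart_mul e).
Local Notation e0 := (cmap e 1%g).
Local Notation al := (chart_act e act).

Let ce0 : ccod e e0 := cmap_cod He1.

Variables (x y : 'rV[R]_p -> 'rV[R]_r) (s : 'rV[R]_p).
Hypotheses (Hx : smooth_on M x) (Hy : smooth_on M y) (Ms : M s).

Variables (g : R -> 'rV[R]_p -> G) (W : set (R^o * 'rV[R]_p)).
Hypotheses (oW : open W) (W0 : forall s, M s -> W (0, s)).
Hypothesis gs : smooth_into (lie_atlas (s := G)) W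
  (fun z : R^o * 'rV[R]_p => g z.1 z.2).
Hypothesis gv : forall s, M s -> has_velocity e (fun t => g t s) (y s).

Variables (k : R -> 'rV[R]_p -> G) (K : set (R^o * 'rV[R]_p)).
Hypotheses (oK : open K) (K0 : forall s, M s -> K (0, s)).
Hypothesis ks : forall t, smooth_into (lie_atlas (s := G)) [set s | K (t, s)] (k t).
Hypothesis kinv : forall t s, K (t, s) ->
  star sd act (g t) (k t) s = 1%g /\ star sd act (k t) (g t) s = 1%g.
Hypothesis kcvg : forall s, M s ->
  (fun z : R^o * 'rV[R]_p => k z.1 z.2) @ ((0 : R^o), s) --> (1%g : G).

Local Notation u := (chart_curve e g).
Local Notation transp := (transport e act g).

Let dx : differentiable x s. Proof. exact: smooth_on_diff Hx Ms. Qed.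
Let dy : differentiable y s. Proof. exact: smooth_on_diff Hy Ms. Qed.

(** * Differentiating the two linear equations *)

Lemma is_derive_along (q : R -> 'rV[R]_p) dq : q 0 = s ->
  is_derive (0 : R) 1 q dq -> is_derive (0 : R) 1 (fun t => x (q t)) ('D_dq x s).
Proof.
move=> q0 qP; have := is_derive_comp qP (g := x).
by rewrite q0; apply.
Qed.

(** As T_0 = 0, the right-hand side starts at x(s), and the velocity of x(q_t) comes from the term
    with D_2 m alone. *)
Lemma bracket_left_equation (q : R -> 'rV[R]_p) dq (A : R -> 'rV[R]_r) :
  q 0 = s -> is_derive (0 : R) 1 q dq ->
  (\forall t \near (0 : R), 'D_(A t, 0) m (e0, u ((t : R^o), q t)) =
    transp q t (x (q t)) + 'D_(0, x (q t)) m (u ((t : R^o), q t), e0)) ->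
  is_derive (0 : R) 1 A ('D_('D_(x s, 0) al (e0, s)) y s + 'D_dq x s
    + chart_br e (y s) (x s)).
Proof.
move=> q0 qP AE.
have uP := is_derive_curve He He1 HM W0 gs gv Ms q0 qP.
have u0 := chart_curve0 gv Ms q0.
have xP := is_derive_along q0 qP.
have TP := is_derive_linapp (linear_transport He He1 HM Hact oW W0 gs gv Ms q0 qP)
  (fun w => is_derive_transport He He1 HM Hact oW W0 gs gv Ms q0 qP w dy) xP.
have SP := is_derive_linapp (linear_mul_r He He1 u0 uP)
  (is_derive_mul_r He He1 u0 uP) xP.
have L0 w : 'D_(w, 0) m (e0, u (0, q 0)) = w.
  by rewrite u0; exact: chart_mul_idr_derive.
apply: is_derive_eq (is_derive_linsolve (linear_mul_l He He1 u0 uP) L0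
  (is_derive_mul_l He He1 u0 uP) (is_deriveD TP SP) AE) _.
have t0 := transport0 He He1 act HM W0 gs gv Ms q0.
rewrite !fctE /= u0 q0 (t0 ('D_dq x s)) (t0 (x s)) add0r addr0.
rewrite !(chart_mul_idl_derive He He1 _ ce0) /chart_br.
by rewrite -!addrA; congr (_ + _); rewrite addrCA addrA.
Qed.

(** T_t now acts on the unknown, so its derivative belongs to the coefficient and is subtracted on
    solving: hence the sign of the derivative of y. [g] stays at s, whence the constant path; only
    [x] follows q. *)
Lemma bracket_right_equation (q : R -> 'rV[R]_p) dq (A : R -> 'rV[R]_r) :
  q 0 = s -> is_derive (0 : R) 1 q dq ->
  (\forall t \near (0 : R), 'D_(A t, 0) m (e0, u ((t : R^o), s)) +
    transp (fun=> s) t (A t) = 'D_(0, x (q t)) m (u ((t : R^o), s), e0)) ->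
  is_derive (0 : R) 1 A (- 'D_('D_(x s, 0) al (e0, s)) y s + 'D_dq x s
    + chart_br e (y s) (x s)).
Proof.
move=> q0 qP AE; have sP := is_derive_cst_fun s.
have uP := is_derive_curve He He1 HM W0 gs gv Ms erefl sP.
have u0 : u (0, s) = e0 := chart_curve0 gv (q := fun=> s) Ms erefl.
have xP := is_derive_along q0 qP.
have SP := is_derive_linapp (linear_mul_r He He1 u0 uP)
  (is_derive_mul_r He He1 u0 uP) xP.
have TL := linear_transport He He1 HM Hact oW W0 gs gv Ms erefl sP.
have LL : \forall t \near (0 : R), linear_fun
    (fun w => 'D_(w, 0) m (e0, u ((t : R^o), s)) + transp (fun=> s) t w).
  apply: filterS (filterI TL (linear_mul_l He He1 u0 uP)) => t [TLt PLt] w.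
  rewrite {1}TLt {1}PLt -big_split /=; apply: eq_bigr => j _.
  by rewrite scalerDr.
have L0 w : 'D_(w, 0) m (e0, u (0, s)) + transp (fun=> s) 0 w = w.
  rewrite u0 (chart_mul_idr_derive He He1 w ce0).
  by rewrite (transport0 He He1 act HM W0 gs gv Ms erefl) addr0.
have LP w := is_deriveD (is_derive_mul_l He He1 u0 uP w)
  (is_derive_transport He He1 HM Hact oW W0 gs gv Ms erefl sP w dy).
apply: is_derive_eq (is_derive_linsolve LL L0 LP SP AE) _.
rewrite /= u0 q0 !(chart_mul_idl_derive He He1 _ ce0) /chart_br opprD.
have aux (a b c d : 'rV[R]_r) : b + d + (- c - a) = - a + d + (b - c).
  by apply/rowP => j; rewrite !mxE; ring.
exact: aux.
Qed.

(** * The star-inverse near the unit section *)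

Lemma inverse0 z : M z -> k 0 z = 1%g.
Proof.
by move=> Mz; exact: hausdorff_cvg_at (@lie_hausdorff _ _ G) (kcvg Mz).
Qed.

Lemma inverse_continuous0 z : M z ->
  {for ((0 : R^o), z), continuous (fun z : R^o * 'rV[R]_p => k z.1 z.2)}.
Proof. by move=> Mz; rewrite /prop_for /continuous_at inverse0//; exact: kcvg. Qed.

Lemma path_pair_continuous (q : R -> 'rV[R]_p) : {for (0 : R), continuous q} ->
  {for (0 : R), continuous (fun t => ((t : R^o), q t))}.
Proof. by move=> qc; apply: for_continuous_pair. Qed.

Lemma inverse_path_continuous (q : R -> 'rV[R]_p) : q 0 = s ->
  {for (0 : R), continuous q} -> {for (0 : R), continuous (fun t => k t (q t))}.
Proof.
move=> q0 qc; apply: (@for_continuous_comp _ _ _ (fun t : R => ((t : R^o), q t))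
  (fun z : R^o * 'rV[R]_p => k z.1 z.2)); first exact: path_pair_continuous.
by rewrite q0; exact: inverse_continuous0.
Qed.

Lemma near_inverse_dom (q : R -> 'rV[R]_p) : q 0 = s ->
  {for (0 : R), continuous q} -> \forall t \near (0 : R),
    [/\ K ((t : R^o), q t), cdom e (k t (q t)) & D (k t (q t), q t)].
Proof.
move=> q0 qc; have kc := inverse_path_continuous q0 qc.
have N1 : \forall t \near (0 : R), K ((t : R^o), q t).
  by apply: near_open (path_pair_continuous qc) oK _; rewrite q0; exact: K0.
have N2 : \forall t \near (0 : R), cdom e (k t (q t)).
  by apply: near_open kc (open_cdom e) _; rewrite q0 inverse0.
have N3 : \forall t \near (0 : R), D (k t (q t), q t).
  apply: (@near_open _ _ (fun t => (k t (q t), q t)) 0 D) (act_open Hact) _.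
    exact: for_continuous_pair kc qc.
  by rewrite q0 inverse0//; exact: act_dom1 Hact _ Ms.
by apply: filterS (filterI N1 (filterI N2 N3)) => t [? []].
Qed.

Lemma gdiff_act (t : R) (z : 'rV[R]_p) : M z -> curve_dom e g W ((t : R^o), z) ->
  gdiff e (fun b => g t (al (b, z))) e0 /\
  forall w, 'D_w (fun b => cmap e (g t (al (b, z)))) e0 =
    'D_(0, 'D_(w, 0) al (e0, z)) u ((t : R^o), z).
Proof.
move=> Mz cz; have dal := (derive_chart_act_l He He1 Hact 0 Mz).1.
have al0 : al (e0, z) = z by rewrite /chart_act /= cmapK//; exact: act1s Hact _ Mz.
have di : differentiable (fun b => ((t : R^o), al (b, z))) e0.
  by apply: differentiable_pair.
rewrite -[in curve_dom e g W _]al0 in cz.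
split=> [|w]; first exact: gdiff_comp di (gdiff_curve He gs cz).
have [_ alE] := derive_chart_act_l He He1 Hact w Mz.
have := derive_comp w di (chart_curve_diff He gs cz).
by rewrite (derive_pair w _ dal) // derive_cst alE al0.
Qed.

Lemma unit_curve_continuous h z : unit_curve e M h x -> M z ->
  [/\ {for (0 : R), continuous (fun t => h t z)}, h 0 z = 1%g,
    has_velocity e (fun t => h t z) (x z)
    & \forall t \near (0 : R), cdom e (h t z)].
Proof.
move=> [V [_ V0 [hc _] hv]] Mz; have hvz := hv z Mz; have [h0 _] := hvz.
have hcz : {for (0 : R), continuous (fun t => h t z)}.
  apply: (@for_continuous_comp _ _ _ (fun t : R => ((t : R^o), z))
    (fun z : R^o * 'rV[R]_p => h z.1 z.2)).
    by apply: path_pair_continuous; exact: cst_continuous.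
  by apply: hc; exact: V0.
split=> //.
by apply: near_open hcz (open_cdom e) _; rewrite h0.
Qed.

(** * Left actions *)

Lemma act_inverse0 : act (k 0 s) s = s.
Proof. by rewrite inverse0//; exact: act1s Hact _ Ms. Qed.

Let kap t := cmap e (k t s).

(** In coordinates g * k = 1 at s reads F(t, kap t) = e0, where F(t, b) stands for g_t(b . s) b.
    Since g_0 = 1, the differential of F at (0, e0) is (t, w) |-> t y(s) + w, the shape required by
    [is_derive_implicit]. *)
Lemma is_derive_inverse : sd = LeftAction ->
  is_derive (0 : R) 1 kap (- y s).
Proof.
move=> sdL; have q0 : (fun=> s) (0 : R) = s by [].
have sc : {for (0 : R), continuous (fun _ : R => s)} by exact: cst_continuous.
have kc := inverse_path_continuous q0 sc.
have kap0 : kap 0 = e0 by rewrite /kap inverse0.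
have kapc : kap h @[h --> (0 : R)] --> e0.
  rewrite -kap0; apply: for_continuous_comp kc _.
  by rewrite inverse0//; exact: cmap_continuous.
have al0 : al (e0, s) = s by rewrite /chart_act /= cmapK//; exact: act1s Hact _ Ms.
have dal := (derive_chart_act_l He He1 Hact 0 Ms).1.
pose j (z : R^o * 'rV[R]_r) : R^o * 'rV[R]_p := (z.1, al (z.2, s)).
have dfst (z : R^o * 'rV[R]_r) : differentiable fst z := differentiable_fst z.
have dsnd (z : R^o * 'rV[R]_r) : differentiable snd z := differentiable_snd z.
have dals : differentiable (fun z : R^o * 'rV[R]_r => al (z.2, s)) (0, e0).
  exact: (differentiable_comp (dsnd (0, e0)) dal).
have dj : differentiable j (0, e0) by exact: differentiable_pair.
have cj : curve_dom e g W (j (0, e0)) by rewrite /j /= al0; exact: (curve_dom0 He1 W0 gv).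
have gg : gdiff e (fun z => g (j z).1 (j z).2) (0, e0).
  exact: gdiff_comp dj (gdiff_curve He gs cj).
have gi : gdiff e (fun z : R^o * 'rV[R]_r => cinv e z.2) (0, e0).
  exact: gdiff_comp (dsnd (0, e0)) (gdiff_cinv ce0).
have g0 : g (j (0, e0)).1 (j (0, e0)).2 = 1%g by rewrite /j /= al0; exact: (curve0 gv).
have ci : cinv e e0 = 1%g by exact: cmapK.
have e11 : cdom e (g (j (0, e0)).1 (j (0, e0)).2 * cinv e (0 : R^o, e0).2)%g.
  by rewrite g0 /= ci mulg1.
have [[_ _ dF] DF] := gdiff_mul He gg gi e11.
apply: is_derive_implicit dF _ kap0 kapc _.
  move=> t w; rewrite DF g0 /= ci.
  have du := chart_curve_diff He gs cj.
  have -> : 'D_(t, w) (fun z => cmap e (cinv e z.2)) ((0 : R^o), e0) = w.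
    have dce : differentiable (fun b => cmap e (cinv e b)) e0.
      by have [] := gdiff_cinv ce0.
    apply: etrans (derive_comp (t, w) (dsnd (0, e0)) dce) _.
    by rewrite derive_snd derive_cinv.
  have -> : 'D_(t, w) (fun z => cmap e (g (j z).1 (j z).2)) ((0 : R^o), e0) = t *: y s.
    transitivity ('D_('D_(t, w) j ((0 : R^o), e0)) u (j ((0 : R^o), e0))).
      exact: (derive_comp (t, w) dj du).
    have -> : 'D_(t, w) j ((0 : R^o), e0) = (t, 'D_w (fun b => al (b, s)) e0).
      have alE : 'D_(t, w) (fun z : R^o * 'rV[R]_r => al (z.2, s)) ((0 : R^o), e0) =
          'D_('D_(t, w) snd ((0 : R^o), e0)) (fun b => al (b, s)) e0.
        exact: (derive_comp (t, w) (dsnd (0, e0)) dal).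
      by rewrite (derive_pair (t, w) (dfst (0, e0)) dals) derive_fst alE derive_snd.
    have jE : j ((0 : R^o), e0) = (0, s) by rewrite /j /= al0.
    rewrite (derive_pair_split _ _ du) jE (derive_curve_s He He1 HM W0 gs gv _ Ms) addr0.
    have -> : (t, 0 : 'rV[R]_p) = (t : R) *: ((1 : R^o), 0 : 'rV[R]_p).
      by congr (_, _); rewrite /= ?scaler0// [_ *: _]mulr1.
    by rewrite derive_dirZ -?jE// jE (derive_curve_t He He1 W0 gs gv Ms).
  have dm : differentiable m (e0, e0) by apply: chart_mul_diff => //; rewrite mulg1.
  rewrite (derive_pair_split _ _ dm) (chart_mul_idr_derive He He1 _ ce0).
  by rewrite (chart_mul_idl_derive He He1 _ ce0).
apply: filterS (near_inverse_dom q0 sc) => t [Kts ek _].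
rewrite g0 /= ci mulg1 /kap /chart_act /= !cmapK//.
by have [] := kinv Kts; rewrite /star sdL => ->.
Qed.

Let psi t := act (k t s) s.

Lemma is_derive_act_inverse : sd = LeftAction ->
  is_derive (0 : R) 1 psi ('D_(- y s, 0) al (e0, s)).
Proof.
move=> sdL; have kP := is_derive_inverse sdL.
have q0 : (fun=> s) (0 : R) = s by [].
have sc : {for (0 : R), continuous (fun _ : R => s)} by exact: cst_continuous.
have [dal alE] := derive_chart_act_l He He1 Hact (- y s) Ms.
have kap0 : kap 0 = e0 by rewrite /kap inverse0.
have := is_derive_comp kP (g := fun b => al (b, s)); rewrite kap0 alE => /(_ dal).
apply: near_eq_is_derive; apply: filterS (near_inverse_dom q0 sc) => t [_ ek _].
by rewrite /chart_act /kap /= cmapK.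
Qed.

(** With b = h(q_t), the left product gives (g_t * h * k_t)(s) = g_t(b . q_t) b k_t(s): the curve
    [h] enters only through its value at the point q_t = [psi t]. *)
Definition Ad_left (t : R) : 'rV[R]_r := 'D_(x (psi t))
  (fun b => cmap e (g t (al (b, psi t)) * cinv e b * k t s)%g) e0.

Lemma star_Ad_left : sd = LeftAction -> \forall t \near (0 : R),
  is_star_Ad e sd M act (g t) (k t) x s (Ad_left t) /\
  'D_(Ad_left t, 0) m (e0, u ((t : R^o), psi t)) =
    transp psi t (x (psi t)) + 'D_(0, x (psi t)) m (u ((t : R^o), psi t), e0).
Proof.
move=> sdL; have q0 : (fun=> s) (0 : R) = s by [].
have sc : {for (0 : R), continuous (fun _ : R => s)} by exact: cst_continuous.
have psi0 : psi 0 = s := act_inverse0.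
have N1 := near_path_curve_dom He1 oW W0 gs gv Ms psi0 (is_derive_act_inverse sdL).
apply: filterS (filterI (near_inverse_dom q0 sc) N1) => t [[Kts ek Dk] cz].
have Mz : M (psi t) := act_cod Hact Dk.
have inv1 : (g t (psi t) * k t s = 1)%g.
  by have [] := kinv Kts; rewrite /star sdL.
have al0 : al (e0, psi t) = psi t by rewrite /chart_act /= cmapK//; exact: act1s Hact _ Mz.
have [gg ggE] := gdiff_act Mz cz.
have gk : gdiff e (fun=> k t s) e0 by exact: gdiff_cst.
have eg : cdom e (g t (psi t)) by case: cz.
have gJ : gdiff e (fun=> g t (psi t)) e0 by exact: gdiff_cst.
have ak : (g t (al (e0, psi t)) * k t s = 1)%g by rewrite al0.
have gQ := gdiff_conj He He1 gg gk ak.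
split.
  split=> [|h hx]; first exact: exists_unit_curve.
  have [hc h0 hv eh] := unit_curve_continuous hx Mz.
  split; first by rewrite sdL /star -/(psi t) h0 (act1s Hact Mz) mulg1.
  apply: velocity_subst gQ hv _; apply: filterS eh => tau etau.
  by rewrite sdL /star /chart_act /= cmapK.
(* J is the constant g_t(q_t), whose inverse in [G] is k_t(s), so its own derivative drops out. *)
have Jg : g t (psi t) = g t (al (e0, psi t)) by rewrite al0.
have := derive_conj He He1 (x (psi t)) gg gk gJ ak Jg.
rewrite derive_cst -/(Ad_left t) ggE al0; apply; apply: filterE => b.
by rewrite -!mulgA -(mulg1_eq inv1) mulVg mulg1.
Qed.

(** * Right actions *)

Let phi t := act (g t s) s.

Lemma is_derive_act_curve : is_derive (0 : R) 1 phi ('D_(y s, 0) al (e0, s)).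
Proof.
have [dal alE] := derive_chart_act_l He He1 Hact (y s) Ms.
have sP := is_derive_cst_fun s.
have := is_derive_comp (is_derive_curve He He1 HM W0 gs gv Ms erefl sP)
  (g := fun b => al (b, s)).
rewrite (chart_curve0 gv (q := fun=> s) Ms erefl) alE => /(_ dal).
apply: near_eq_is_derive.
apply: filterS (near_path_curve_dom He1 oW W0 gs gv Ms erefl sP) => t [_ eg].
by rewrite /chart_act /chart_curve /= cmapK.
Qed.

Lemma act_curve0 : phi 0 = s.
Proof. by rewrite /phi (curve0 gv Ms); exact: act1s Hact _ Ms. Qed.

(** With b = h(q_t) and q_t = [phi t], (g_t * h)(s) = g_t(s) b moves s to b . q_t; this is the
    point, depending on b, where [k t] is evaluated. *)
Definition Ad_right (t : R) : 'rV[R]_r := 'D_(x (phi t))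
  (fun b => cmap e (g t s * cinv e b * k t (al (b, phi t)))%g) e0.

Lemma star_Ad_right : sd = RightAction -> \forall t \near (0 : R),
  is_star_Ad e sd M act (g t) (k t) x s (Ad_right t) /\
  'D_(Ad_right t, 0) m (e0, u ((t : R^o), s)) + transp (fun=> s) t (Ad_right t) =
    'D_(0, x (phi t)) m (u ((t : R^o), s), e0).
Proof.
move=> sdR; have q0 : (fun=> s) (0 : R) = s by [].
have sc : {for (0 : R), continuous (fun _ : R => s)} by exact: cst_continuous.
have sP := is_derive_cst_fun s.
have phic : {for (0 : R), continuous phi} by exact: is_derive_continuous is_derive_act_curve.
have N1 := near_path_curve_dom He1 oW W0 gs gv Ms erefl sP.
have N2 : \forall t \near (0 : R), D (g t s, s).
  apply: (@near_open _ _ (fun t => (g t s, s)) 0 D) (act_open Hact) _.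
    apply: for_continuous_pair; last exact: sc.
    apply: (@for_continuous_comp _ _ _ (fun t : R => ((t : R^o), s))
      (fun z : R^o * 'rV[R]_p => g z.1 z.2)).
      exact: path_pair_continuous sc.
    by apply: (curve_continuous gs); exact: W0.
  by rewrite (curve0 gv Ms); exact: act_dom1 Hact _ Ms.
apply: filterS (filterI (filterI (near_inverse_dom q0 sc) (near_inverse_dom act_curve0 phic))
  (filterI N1 N2)) => t [[[Kts _ _] [Ktz ekz Dkz]] [cs Dgs]].
have Mz : M (phi t) := act_cod Hact Dgs.
have inv1 : (g t s * k t (phi t) = 1)%g.
  by have [] := kinv Kts; rewrite /star sdR.
have ci : cinv e e0 = 1%g by exact: cmapK.
have al0 z : M z -> al (e0, z) = z.
  by move=> ?; rewrite /chart_act /= ci; exact: act1s Hact _ _.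
have [_ eg] := cs.
have ga : gdiff e (fun=> g t s) e0 by exact: gdiff_cst.
have dal := (derive_chart_act_l He He1 Hact 0 Mz).1.
have gk : gdiff e (fun b => k t (al (b, phi t))) e0.
  apply: (gdiff_comp (f := k t) dal); rewrite al0//.
  exact: gdiff_smooth_into (ks t) Ktz ekz.
have ak : (g t s * k t (al (e0, phi t)) = 1)%g by rewrite al0.
have gQ := gdiff_conj He He1 ga gk ak.
set Q := fun b => (g t s * cinv e b * k t (al (b, phi t)))%g in gQ *.
have Q0 : Q e0 = 1%g by rewrite /Q ci mulg1 ak.
have [Qc _ dQ] := gQ; have eQ := gdiff_near gQ.
have ic : {for e0, continuous (cinv e)} by exact: cinv_continuous.
have alc := differentiable_continuous dal.
(* The action is local, so its composition law applies only to pairs in [D]. The pairs needed are in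
   [D] at b = e0, and stay there for b near e0 because [D] is open. *)
have E1 : \forall b \near e0, D (cinv e b, phi t).
  apply: (@near_open _ _ (fun b => (cinv e b, phi t)) e0 D) (act_open Hact) _.
    by apply: for_continuous_pair ic _; exact: cst_continuous.
  by rewrite ci; exact: act_dom1 Hact _ Mz.
have eg1 : cdom e (g t s * cinv e e0)%g by rewrite ci mulg1.
have [[gic _ _] _] := gdiff_mul He ga (gdiff_cinv ce0) eg1.
have E2 : \forall b \near e0, D ((g t s * cinv e b)%g, s).
  apply: (@near_open _ _ (fun b => ((g t s * cinv e b)%g, s)) e0 D) (act_open Hact) _.
    by apply: for_continuous_pair gic _; exact: cst_continuous.
  by rewrite ci mulg1.
have [kc _ _] := gk.
have E3 : \forall b \near e0, D (k t (al (b, phi t)), al (b, phi t)).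
  apply: (@near_open _ _ (fun b => (k t (al (b, phi t)), al (b, phi t))) e0 D)
    (act_open Hact) _.
    exact: for_continuous_pair kc alc.
  by rewrite al0.
have E4 : \forall b \near e0, D (Q b, s).
  apply: (@near_open _ _ (fun b => (Q b, s)) e0 D) (act_open Hact) _.
    by apply: for_continuous_pair Qc _; exact: cst_continuous.
  by rewrite Q0; exact: act_dom1 Hact _ Ms.
have E5 : \forall b \near e0, K ((t : R^o), al (b, phi t)).
  apply: (@near_open _ _ (fun b => ((t : R^o), al (b, phi t))) e0 K) oK _.
    by apply: for_continuous_pair alc; exact: cst_continuous.
  by rewrite al0.
have compE b : D (cinv e b, phi t) -> D ((g t s * cinv e b)%g, s) ->
    act (g t s * cinv e b)%g s = al (b, phi t).
  move=> D1 D2; have := act_comp Hact Dgs D1; rewrite /side_mul sdR.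
  by move=> /(_ D2) <-.
split.
  split=> [|h hx]; first exact: exists_unit_curve.
  have [hc h0 hv eh] := unit_curve_continuous hx Mz.
  split; first by rewrite sdR /star -/(phi t) h0 mulg1 -/(phi t).
  apply: velocity_subst gQ hv _.
  have hcc : {for (0 : R), continuous (fun tau => cmap e (h tau (phi t)))}.
    by apply: for_continuous_comp hc _; rewrite h0; exact: cmap_continuous.
  have E12 : \forall tau \near (0 : R), D (cinv e (cmap e (h tau (phi t))), phi t) /\
      D ((g t s * cinv e (cmap e (h tau (phi t))))%g, s).
    have E0 : nbhs (cmap e (h 0 (phi t))) [set b | D (cinv e b, phi t) /\
        D ((g t s * cinv e b)%g, s)] by rewrite h0; exact: filterI E1 E2.
    exact: hcc _ E0.
  apply: filterS (filterI eh E12) => tau [etau [D1 D2]].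
  have := compE _ D1 D2.
  by rewrite /Q cmapK// sdR /star -/(phi t) => ->.
have [gJ0 JE] := gdiff_act (t := t) Ms cs.
have dQ' : differentiable (fun b => cmap e (Q b)) e0 by [].
have gJ : gdiff e (fun b => g t (al (cmap e (Q b), s))) e0.
  apply: (gdiff_comp (f := fun b => g t (al (b, s))) dQ').
  by rewrite Q0.
have Jg : g t (al (cmap e (Q e0), s)) = g t s by rewrite Q0 al0.
(* With z = b . q_t, the factor k_t(z) g_t(k_t(z) . z) is 1 by k * g = 1, and k_t(z) . z is Q(b) . s
   by the composition law. *)
have QJ : \forall b \near e0,
    (Q b * g t (al (cmap e (Q b), s)) = g t s * cinv e b)%g.
  apply: filterS (filterI (filterI E1 (filterI E2 E3)) (filterI eQ (filterI E4 E5))).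
  move=> b [[D1 [D2 D3]] [eQb [D4 Kb]]].
  have c1 := compE _ D1 D2.
  have D3' : D (k t (al (b, phi t)), act (g t s * cinv e b)%g s) by rewrite c1.
  have := act_comp Hact D2 D3'; rewrite /side_mul sdR => /(_ D4); rewrite c1 => c2.
  have [_] := kinv Kb; rewrite /star sdR c2 => kg.
  by rewrite {1}/chart_act /= cmapK// /Q -mulgA kg mulg1.
have := derive_conj He He1 (x (phi t)) ga gk gJ ak Jg QJ.
rewrite derive_cst add0r -/Q -/(Ad_right t) => <-.
(* J(b) = g_t(Q(b) . s) depends on b through Q, whose derivative is the unknown [Ad_right t]
   itself. *)
have -> : 'D_(x (phi t)) (fun b => cmap e (g t (al (cmap e (Q b), s)))) e0 =
    transp (fun=> s) t (Ad_right t).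
  have dgs : differentiable (fun b => cmap e (g t (al (b, s)))) (cmap e (Q e0)).
    by rewrite Q0; case: gJ0.
  apply: etrans (derive_comp (x (phi t)) dQ' dgs) _.
  by rewrite Q0 JE.
have dm : differentiable m (e0, cmap e (g t s)).
  by apply: chart_mul_diff => //; rewrite mul1g.
rewrite (derive_pair_split (Ad_right t) (transp (fun=> s) t (Ad_right t)) dm).
by rewrite (chart_mul_idl_derive He He1 _ (cmap_cod eg)).
Qed.

End Bracket.

Theorem theorem4p2 (R : realType) (p r : nat) (G : lieGroupType R r)
    (e : chart R r G) (He : lie_atlas (s := G) e) (He1 : cdom e 1%g)
    (expG : 'rV[R]_r -> G) (HexpG : is_lie_exp e expG)
    (v : r.-tuple 'rV[R]_r) (Hv : basis_of fullv v)
    (sd : action_side) (M : set 'rV[R]_p) (HM : open M)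
    (D : set (G * 'rV[R]_p)) (act : G -> 'rV[R]_p -> 'rV[R]_p)
    (Hact : local_action sd M D act)
    (x y : 'rV[R]_p -> 'rV[R]_r) (Hx : smooth_on M x) (Hy : smooth_on M y)
    (s : 'rV[R]_p) (Hs : M s) :
  is_star_bracket e sd M act y x s (- dbracket e expG sd act v y x s).
Proof.
move=> g k [W [oW W0 gs gv]] [K [oK K0 ks kinv kcvg]].
have dx := smooth_on_diff Hx Hs; have dy := smooth_on_diff Hy Hs.
have dal := chart_act_diff0 He He1 Hact Hs.
(* These three identities eliminate the basis and the exponential map, leaving derivatives of [m],
   of the action, and of x and y. *)
have xy := lie_derivE He He1 Hact HexpG Hv x Hs dy.
have yx := lie_derivE He He1 Hact HexpG Hv y Hs dx.
have br := lie_brE He He1 (y s) (x s) HexpG.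
rewrite /dbracket; case: sd Hact kinv xy yx => Ha kinv xy yx.
- have near_Ad := star_Ad_left He He1 HM Ha Hx Hs oW W0 gs gv oK K0 kinv kcvg erefl.
  have qP := is_derive_act_inverse He He1 HM Ha Hs W0 gs gv oK K0 kinv kcvg erefl.
  exists (Ad_left e act x s g k); first by apply: filterS near_Ad => t [].
  apply: is_derive_eq (bracket_left_equation He He1 HM Ha Hx Hy Hs oW W0 gs gv
    (act_inverse0 Ha Hs kcvg) qP _) _; first by apply: filterS near_Ad => t [].
  have -> : ((- y s, 0) : 'rV[R]_r * 'rV[R]_p) = - (y s, 0) by rewrite /= -[RHS]/(_, _) oppr0.
  rewrite xy yx br (derive_dirN _ dal) (derive_dirN _ dx).
  have aux (a b c : 'rV[R]_r) : a - b + c = - (b - a - c).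
    by apply/rowP => j; rewrite !mxE; ring.
  exact: aux.
- have near_Ad := star_Ad_right He He1 HM Ha Hx Hs oW W0 gs gv oK K0 ks kinv kcvg erefl.
  have qP := is_derive_act_curve He He1 HM Ha Hs oW W0 gs gv.
  exists (Ad_right e act x s g k); first by apply: filterS near_Ad => t [].
  apply: is_derive_eq (bracket_right_equation He He1 HM Ha Hx Hy Hs oW W0 gs gv
    (act_curve0 Ha Hs gv) qP _) _; first by apply: filterS near_Ad => t [].
  rewrite xy yx br.
  have aux (a b c : 'rV[R]_r) : - a + b + c = - (- b + a - c).
    by apply/rowP => j; rewrite !mxE; ring.
  exact: aux.
Qed.
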